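(* Let $I$ and $\tilde{I}$ be two cells in $\mathbb{R}$ and let $\mathbf{T} : \mathbf{KH}(\tilde{I}) \to \mathbf{KH}(I)$ be a linear operator, where both spaces are equipped with the Alexiewicz norm $\|\cdot\|_A$. The following are equivalent. (A) $\mathbf{T}$ is a surjective isometry. (B) There exist $\sigma \in \{-1,1\}$ and an increasing homeomorphism $\phi : I \to \tilde{I}$ such that both $\phi$ and $\phi^{-1}$ are absolutely continuous and $$\mathbf{T}(\boldsymbol{f}) = [\sigma \cdot (f \circ \phi) \cdot \phi']$$ for all $\boldsymbol{f} \in \mathbf{KH}(\tilde{I})$ and all $f \in \boldsymbol{f}$.
   Context: A cell is a non-degenerate compact interval of $\mathbb{R}$; $|J| = \max J - \min J$ is the length of a cell $J$. Two cells are non-overlapping if their intersection is empty or a singleton. A $P$-family $\Pi$ is a finite set of pairs $(J,x)$, where $J$ is a cell and $x\in J$, such that $J_1,J_2$ are non-overlapping whenever $(J_1,x_1),(J_2,x_2)\in\Pi$ and $J_1\neq J_2$. It is a $P$-division of a cell $I$ if the union of its cells is $I$. A gauge on $I$ is a function $\delta : I \to (0,\infty)$ (not assumed measurable or continuous). A $P$-family $\Pi$ in $I$ (all its cells contained in $I$) is $\delta$-fine if $J \subseteq [x-\delta(x),x+\delta(x)]$ for all $(J,x)\in\Pi$. A function $f : I \to \mathbb{R}$ is Kurzweil-Henstock integrable in $I$ if there is $r \in \mathbb{R}$ such that for every $\varepsilon>0$ there is a gauge $\delta$ on $I$ with $\left|\sum_{(J,x)\in\Pi} f(x)|J| - r\right|<\varepsilon$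 for all $\delta$-fine $P$-divisions $\Pi$ of $I$. In that case $r$ is unique and is denoted $\int_I f$. $KH(I)$ is the vector space of all Kurzweil-Henstock integrable functions on $I$; restrictions of members of $KH(I)$ to cells $J\subseteq I$ belong to $KH(J)$. $\mathbf{KH}(I)$ is the quotient of $KH(I)$ by the subspace of those functions that vanish Lebesgue-almost everywhere; $[f]$ denotes the class of $f$. (Altering a function on a Lebesgue-negligible set affects neither integrability nor the integral.) The Alexiewicz norm on $\mathbf{KH}(I)$ is $$\|\boldsymbol{f}\|_A = \max\left\{ \left|\int_{[\min I,x]} f\right| : \min I < x \leq \max I\right\}, \qquad f\in\boldsymbol{f}.$$ A function $g$ on a cell $I$ is absolutely continuous if for every $\varepsilon>0$ there is $\delta>0$ such that $\sum_{n=1}^N |g(\max J_n)-g(\min J_n)|<\varepsilon$ whenever $J_1,\ldots,J_N\subseteq I$ are pairwise non-overlapping cells with $\sum_{n=1}^N|J_n|<\delta$. In (B), $\phi'$ is defined only almost everywhere; the function $(f\circ\phi)\cdot\phi'$ is given the value $0$ at points where $\phi$ is not differentiable (this choice does not affect the equivalence class).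
   Formalization: In a P-family, cells are required to be non-overlapping for distinct pairs (J1,x1), (J2,x2), not only when J1 and J2 differ: otherwise one cell could carry many tags and nonzero constants would not be Kurzweil-Henstock integrable. *)

(* Defs.v *)
From HB Require Import structures.
From mathcomp Require Import all_boot all_order all_algebra.
From mathcomp Require Import finmap generic_quotient ring_quotient.
From mathcomp Require Import all_classical all_reals all_analysis.

Set Implicit Arguments.
Unset Strict Implicit.
Unset Printing Implicit Defensive.

Import Order.TTheory GRing.Theory Num.Theory.
Import numFieldNormedType.Exports.

Local Open Scope classical_set_scope.
Local Open Scope ring_scope.
Local Open Scope quotient_scope.

Record cell (R : realType) := Cell { ends : R * R ; _ : ends.1 < ends.2 }.

HB.instance Definition _ (R : realType) := [isSub for @ends R].
HB.instance Definition _ (R : realType) := [Choice of cell R by <:].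

Section Cells.
Context {R : realType}.
Implicit Types J K : cell R.

Definition cmin J : R := (ends J).1.
Definition cmax J : R := (ends J).2.
Definition cset J : set R := `[cmin J, cmax J].
Definition clen J : R := cmax J - cmin J.

Definition nonoverlapping J K : Prop :=
  cset J `&` cset K = set0 \/ exists x, cset J `&` cset K = [set x].

End Cells.

(* Functions on a cell I are represented by total functions R -> R, of which
   only the values on I are ever used. *)
Section KurzweilHenstock.
Context {R : realType}.
Implicit Types (I J : cell R) (P : {fset cell R * R}) (f d : R -> R).

(* Non-overlapping is required of distinct tagged cells, so that no cell
   occurs in P with two different tags; otherwise repeating cells would make
   the Riemann sums of nonzero constants unbounded. *)
Definition Pfamily P : Prop :=
  (forall p, p \in P -> cset p.1 p.2) /\
  (forall p q, p \in P -> q \in P -> p <> q -> nonoverlapping p.1 q.1).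

Definition Pdivision I P : Prop :=
  Pfamily P /\ \bigcup_(p in [set` P]) cset p.1 = cset I.

Definition gauge_on I d : Prop := forall x, cset I x -> 0 < d x.

Definition fine_for d P : Prop :=
  forall p, p \in P -> cset p.1 `<=` `[p.2 - d p.2, p.2 + d p.2].

Definition KHsum f P : R := \sum_(p <- P) f p.2 * clen p.1.

Definition is_KHint I f (r : R) : Prop :=
  forall e : R, 0 < e -> exists2 d, gauge_on I d &
    forall P, Pdivision I P -> fine_for d P -> `|KHsum f P - r| < e.

Definition KHintegrable I f : Prop := exists r, is_KHint I f r.

(* The (unique) value of the integral, and 0 if f is not integrable in I. *)
Definition KHint I f : R := xget 0 [set r | is_KHint I f r].

Definition KH I : {pred R -> R} := [pred f | `[< KHintegrable I f >]].

Lemma is_KHint0 I : is_KHint I 0 0.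
Proof.
move=> e e0; exists (fun=> 1) => [x _ //|P _ _].
by rewrite /KHsum big1 ?subrr ?normr0 // => p _; rewrite mul0r.
Qed.

Lemma is_KHintD I f g r s :
  is_KHint I f r -> is_KHint I g s -> is_KHint I (f + g) (r + s).
Proof.
move=> fr gs e e0; have e20 : 0 < e / 2 by rewrite divr_gt0.
have [d1 d1g H1] := fr _ e20; have [d2 d2g H2] := gs _ e20.
exists (fun x => Num.min (d1 x) (d2 x)) => [x Ix|P PI Pf].
  by rewrite lt_min d1g // d2g.
have sub d : (forall x, Num.min (d1 x) (d2 x) <= d x) -> fine_for d P.
  move=> dd p pP x /(Pf p pP) /=; rewrite !in_itv /= => /andP[lx ux].
  apply/andP; split.
    by apply: le_trans lx; rewrite lerD2l lerN2.
  by apply: le_trans ux _; rewrite lerD2l.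
have -> : KHsum (f + g) P = KHsum f P + KHsum g P.
  by rewrite /KHsum -big_split /=; apply: eq_bigr => p _; rewrite mulrDl.
rewrite opprD addrACA (splitr e); apply: le_lt_trans (ler_normD _ _) _.
apply: ltrD; [apply: H1 => //|apply: H2 => //]; apply: sub => x.
  by rewrite ge_min lexx.
by rewrite ge_min lexx orbT.
Qed.

Lemma is_KHintZ I (a : R) f r : is_KHint I f r -> is_KHint I (a *: f) (a * r).
Proof.
move=> fr e e0; have a1 : 0 < `|a| + 1 by rewrite ltr_wpDl.
have [d dg H] := fr _ (divr_gt0 e0 a1); exists d => // P PI Pf.
have -> : KHsum (a *: f) P = a * KHsum f P.
  rewrite /KHsum mulr_sumr; apply: eq_bigr => p _.
  by rewrite scalrfctE mulrA.
rewrite -mulrBr normrM; have := H P PI Pf; rewrite ltr_pdivlMr // => He.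
apply: le_lt_trans He; rewrite mulrC ler_wpM2l // lerDl //.
Qed.

Lemma KH_submod_closed I : submod_closed (KH I).
Proof.
split; first by apply/asboolP; exists 0; exact: is_KHint0.
move=> a f g /asboolP[r fr] /asboolP[s gs]; apply/asboolP.
by exists (a * r + s); apply: is_KHintD => //; exact: is_KHintZ.
Qed.

HB.instance Definition _ I :=
  GRing.isSubmodClosed.Build R (R -> R) (KH I) (KH_submod_closed I).

End KurzweilHenstock.

Record KHfun (R : realType) (I : cell R) :=
  KHFun { KHval : R -> R ; _ : KHval \in KH I }.

Section KHspace.
Context {R : realType} (I : cell R).

HB.instance Definition _ := [isSub for @KHval R I].
HB.instance Definition _ := [Choice of KHfun I by <:].
HB.instance Definition _ := [SubChoice_isSubLmodule of KHfun I by <:].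

Definition null_on (f : R -> R) : Prop :=
  (@lebesgue_measure R).-negligible [set x | cset I x /\ f x <> 0].

Definition KHnull : {pred KHfun I} := [pred f | `[< null_on (KHval f) >]].

Lemma KHnull_submod_closed : submod_closed KHnull.
Proof.
split.
  apply/asboolP; apply: negligibleS (negligible_set0 _) => x /= [_]; exact.
move=> a f g /asboolP nf /asboolP ng; apply/asboolP.
apply: negligibleS (negligibleU nf ng) => x /= [Ix fgx].
have [f0|f0] := pselect (KHval f x = 0); last by left.
by right; split=> // g0; apply: fgx; rewrite /= !fctE f0 g0 scaler0 addr0.
Qed.

HB.instance Definition _ :=
  GRing.isSubmodClosed.Build R (KHfun I) KHnull KHnull_submod_closed.

Definition KHspace : Type := Quotient.quot (KHnull : zmodClosed (KHfun I)).

HB.instance Definition _ := GRing.Zmodule.on KHspace.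
HB.instance Definition _ := EqQuotient.on KHspace.

Definition KHscale (a : R) (F : KHspace) : KHspace :=
  \pi_KHspace (a *: repr F).

Lemma KHscale_pi a (f : KHfun I) :
  KHscale a (\pi_KHspace f) = \pi_KHspace (a *: f).
Proof.
apply/eqP; rewrite /KHscale -Quotient.idealrBE -scalerBr rpredZ //.
by rewrite Quotient.idealrBE; apply/eqP; exact: (@reprK _ KHspace).
Qed.

Let piD (f g : KHfun I) : \pi_KHspace (f + g) = \pi_KHspace f + \pi_KHspace g.
Proof. exact: Quotient.pi_add. Qed.

Let piP (F : KHspace) : exists f, F = \pi_KHspace f.
Proof. by exists (repr F); rewrite (@reprK _ KHspace). Qed.

Let KHscaleA a b F : KHscale a (KHscale b F) = KHscale (a * b) F.
Proof. by have [f ->] := piP F; rewrite !KHscale_pi scalerA. Qed.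
Let KHscale1 : left_id 1 KHscale.
Proof. by move=> F; have [f ->] := piP F; rewrite KHscale_pi scale1r. Qed.
Let KHscaleDr : right_distributive KHscale +%R.
Proof.
move=> a F G; have [f ->] := piP F; have [g ->] := piP G.
by rewrite -piD !KHscale_pi scalerDr piD.
Qed.
Let KHscaleDl F : {morph KHscale^~ F : a b / a + b}.
Proof.
by move=> a b; have [f ->] := piP F; rewrite !KHscale_pi scalerDl piD.
Qed.

HB.instance Definition _ := GRing.Zmodule_isLmodule.Build R KHspace
  KHscaleA KHscale1 KHscaleDr KHscaleDl.

(* f belongs to the class F; equivalently, f is KH-integrable and F = [f] *)
Definition in_class (F : KHspace) (f : R -> R) : Prop :=
  exists fKH : f \in KH I, F = \pi_KHspace (KHFun fKH).

(* The cells J with the same left end as I and right end at most that of I are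
   the cells [min I, x] with min I < x <= max I.  The integrals do not depend on
   the representative, and their supremum is attained because the primitive of
   an integrable function is continuous. *)
Definition normA (F : KHspace) : R :=
  sup [set `|KHint J (KHval (repr F))| | J in
        [set J : cell R | cmin J = cmin I /\ cmax J <= cmax I]].

End KHspace.

Section Maps.
Context {R : realType}.
Implicit Types (I K : cell R) (g phi psi : R -> R).

Definition surjective_isometry I K (T : KHspace K -> KHspace I) : Prop :=
  (forall F G, normA (T F - T G) = normA (F - G)) /\
  (forall H, exists F, T F = H).

Definition abs_continuous I g : Prop :=
  forall e : R, 0 < e -> exists2 d : R, 0 < d &
    forall (n : nat) (J : 'I_n -> cell R),
      (forall i, cset (J i) `<=` cset I) ->
      (forall i j, i != j -> nonoverlapping (J i) (J j)) ->
      \sum_(i < n) clen (J i) < d ->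
      \sum_(i < n) `|g (cmax (J i)) - g (cmin (J i))| < e.

(* phi restricts to an increasing homeomorphism from I onto K, with inverse
   the restriction of psi to K *)
Definition increasing_homeo I K phi psi : Prop :=
  [/\ set_fun (cset I) (cset K) phi, set_fun (cset K) (cset I) psi,
      {in cset I, cancel phi psi} & {in cset K, cancel psi phi}] /\
  [/\ {within cset I, continuous phi}, {within cset K, continuous psi} &
      {in cset I &, {homo phi : x y / x < y}}].

(* At the two ends of I the value depends on phi outside I; this is harmless
   since the function is only used modulo null functions. *)
Definition derivative0 phi (x : R) : R :=
  if `[< derivable phi x 1 >] then derive1 phi x else 0.

End Maps.

(* Main.v *)
From HB Require Import structures.
Require Import Defs.
From mathcomp Require Import all_boot all_order all_algebra.
From mathcomp Require Import finmap generic_quotient ring_quotient ring lra.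
From mathcomp Require Import all_classical all_reals all_analysis.

Set Implicit Arguments.
Unset Strict Implicit.
Unset Printing Implicit Defensive.

Import Order.TTheory GRing.Theory Num.Theory.
Import numFieldNormedType.Exports.

Local Open Scope classical_set_scope.
Local Open Scope ring_scope.

(** For a class F let prim F be the primitive, vanishing at min I, of the members
    of F. The Alexiewicz norm of F is the maximum of the absolute value of prim F,
    so that a surjective isometry T between the spaces of classes is an isometry
    for the maximum norm between spaces of continuous functions, and an argument
    of Banach-Stone type applies, completeness of the spaces being replaced by an
    explicit peak function at each point. It gives a sign sigma and a
    homeomorphism phi with

      prim (T F) x = sigma * prim F (phi x)        (isometry_representation).

    Conversely such a formula visibly defines a surjective isometry. The theorem
    thus amounts to translating the composition F o phi of primitives into a
    substitution (f o phi) phi' of integrands and back.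

    Taking for F the class of the constant function 1 shows that phi itself is,
    up to a constant, a Kurzweil-Henstock primitive. An increasing primitive has
    property (N): it maps null sets to null sets (primitive_null_cont). So does
    an absolutely continuous function (abs_continuous_null_cont). For a
    continuous nondecreasing phi, property (N) says that the Stieltjes measure of
    phi is absolutely continuous with respect to Lebesgue measure; this gives
    both absolute continuity of phi (null_cont_abs_continuous) and, through the
    Radon-Nikodym theorem and Lebesgue's differentiation theorem, that phi is a
    primitive of its almost everywhere derivative (null_cont_primitive). The
    chain rule for primitives (primitive_comp) then shows that (f o phi) phi' has
    the primitive F o phi, without any assumption on f beyond integrability.

    All these steps are carried by one notion: a function F is a primitive of f
    if the sums of |f t * |J| - (F (max J) - F (min J))| over fine families of
    tagged cells (J, t) are as small as desired. That integrable functions have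
    primitives in this sense is the Saks-Henstock lemma (is_KHint_primitive). In
    this form almost everywhere arguments need no measurability: the sums can be
    split according to the position of the tags, so they stay small when
    multiplied by any weight depending on the tag (negl_var_weight). Null sets
    enter through negl_var_null and negl_var_measure0. *)

(** * Cells and non-overlapping families *)

Section Cells.
Context {R : realType}.
Implicit Types (I J K : cell R) (P Q : {fset cell R * R}) (f d F W : R -> R).

Definition incr F J : R := F (cmax J) - F (cmin J).

Lemma cmin_lt J : cmin J < cmax J.
Proof. by case: J. Qed.

Lemma clen_ge0 J : 0 <= clen J.
Proof. by rewrite subr_ge0 ltW // cmin_lt. Qed.

Lemma cminE x y (h : (x, y).1 < (x, y).2) : cmin (@Cell R (x, y) h) = x.
Proof. by []. Qed.

Lemma cmaxE x y (h : (x, y).1 < (x, y).2) : cmax (@Cell R (x, y) h) = y.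
Proof. by []. Qed.

Lemma csetP J x : cset J x <-> cmin J <= x <= cmax J.
Proof. by rewrite /cset /= in_itv. Qed.

Lemma cset_min J : cset J (cmin J).
Proof. by apply/csetP; rewrite lexx ltW // cmin_lt. Qed.

Lemma cset_max J : cset J (cmax J).
Proof. by apply/csetP; rewrite lexx ltW // cmin_lt. Qed.

Lemma cset_subP J K : cset J `<=` cset K <-> cmin K <= cmin J /\ cmax J <= cmax K.
Proof.
split=> [JK|[h1 h2] x /csetP/andP[x1 x2]].
  have /csetP/andP[? _] := JK _ (cset_min J).
  by have /csetP/andP[_ ?] := JK _ (cset_max J).
by apply/csetP; rewrite (le_trans h1) // (le_trans x2).
Qed.

Lemma nonoverlappingP J K :
  nonoverlapping J K <-> cmax J <= cmin K \/ cmax K <= cmin J.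
Proof.
have ltJ := cmin_lt J; have ltK := cmin_lt K; split.
  move=> JK; apply: contrapT => /not_orP[/negP + /negP].
  rewrite -!ltNge => h1 h2.
  set l := Num.max (cmin J) (cmin K); set u := Num.min (cmax J) (cmax K).
  have lu : l < u by rewrite /l /u gt_max !lt_min ltJ ltK h1 h2.
  have in2 z : l <= z <= u -> (cset J `&` cset K) z.
    rewrite /l /u ge_max le_min => /andP[/andP[? ?] /andP[? ?]].
    by split; apply/csetP; apply/andP.
  have Hl : (cset J `&` cset K) l by apply: in2; rewrite lexx ltW.
  have Hu : (cset J `&` cset K) u by apply: in2; rewrite lexx ltW.
  case: JK => [E|[x E]]; first by rewrite E in Hl.
  by move: lu; have := Hl; have := Hu; rewrite E => /= -> ->; rewrite ltxx.
move=> H; have [E|/set0P[x [Jx Kx]]] := eqVneq (cset J `&` cset K) set0.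
  by left.
right; exists x; apply/seteqP; split=> [y [Jy Ky]|_ ->] //=.
move: Jx Kx Jy Ky => /csetP/andP[? ?] /csetP/andP[? ?] /csetP/andP[? ?].
by move=> /csetP/andP[? ?]; case: H => ?; lra.
Qed.

Lemma PfamilyS P Q : {subset P <= Q} -> Pfamily Q -> Pfamily P.
Proof.
move=> PQ [tagQ nonQ]; split=> [p /PQ|p q /PQ pQ /PQ qQ]; first exact: tagQ.
exact: nonQ.
Qed.

Lemma Pfamily_rightmost P : Pfamily P -> P != fset0 ->
  exists2 p, p \in P & forall q, q \in P -> q <> p -> cmax q.1 <= cmin p.1.
Proof.
move=> [_ nonP] /fset0Pn[p0 p0P].
have : exists2 p, p \in P & forall q, q \in P -> cmax q.1 <= cmax p.1.
  elim/finSet_rect: P p0 p0P {nonP} => P IH p0 p0P.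
  have [P1|/fset0Pn[q0 q0P]] := eqVneq (P `\ p0)%fset fset0.
    exists p0 => // q qP; have [->//|qp0] := eqVneq q p0.
    by have : q \in (P `\ p0)%fset; [rewrite !inE qp0 | rewrite P1 inE].
  have [|p pP maxp] := IH _ _ q0 q0P; first by rewrite fproperD1.
  have pP' : p \in P by move: pP; rewrite !inE => /andP[].
  have [le0|/ltW le0] := leP (cmax p0.1) (cmax p.1).
    exists p => // q qP; have [->//|qp0] := eqVneq q p0.
    by apply: maxp; rewrite !inE qp0.
  exists p0 => // q qP; have [->//|qp0] := eqVneq q p0.
  by apply: le_trans le0; apply: maxp; rewrite !inE qp0.
case=> p pP maxp; exists p => // q qP qp.
have /nonoverlappingP[//|] := nonP q p qP pP qp.
by have := maxp q qP; have := cmin_lt q.1; lra.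
Qed.

(** A finite set of non-overlapping cells is ordered from left to right, which
    makes induction on the rightmost cell available. *)
Lemma Pfamily_ind (H : {fset cell R * R} -> Prop) :
  H fset0 ->
  (forall P p, p \notin P -> Pfamily P -> cset p.1 p.2 ->
    (forall q, q \in P -> cmax q.1 <= cmin p.1) -> H P -> H (p |` P)%fset) ->
  forall P, Pfamily P -> H P.
Proof.
move=> H0 HS; elim/finSet_rect => P IH famP.
have [->//|P0] := eqVneq P fset0.
have [p pP maxp] := Pfamily_rightmost famP P0.
have famP' : Pfamily (P `\ p)%fset.
  by apply: PfamilyS famP => q; rewrite !inE => /andP[].
rewrite -(fsetD1K pP); apply: HS => //; first by rewrite !inE eqxx.
- by case: famP => tagP _; exact: tagP.
- by move=> q; rewrite !inE => /andP[/eqP qp qP]; exact: maxp.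
- by apply: IH => //; rewrite fproperD1.
Qed.

Lemma sum_fsetU1 (q : cell R * R -> R) P p : p \notin P ->
  \sum_(x <- (p |` P)%fset) q x = q p + \sum_(x <- P) q x.
Proof. by move=> pP; rewrite big_fsetU1. Qed.

(** Increments of a nondecreasing function over non-overlapping cells add up
    to at most its total increment, since the gaps contribute nonnegatively. *)
Lemma sum_incr_le I W P : Pfamily P ->
  (forall x y, cset I x -> cset I y -> x <= y -> W x <= W y) ->
  (forall p, p \in P -> cset p.1 `<=` cset I) ->
  \sum_(p <- P) incr W p.1 <= incr W I.
Proof.
move=> famP ndW; have minI := cset_min I; have maxI := cset_max I.
suff H b : cset I b -> (forall p, p \in P -> cset p.1 `<=` cset I) ->
    (forall p, p \in P -> cmax p.1 <= b) ->
    \sum_(p <- P) incr W p.1 <= W b - W (cmin I).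
  move=> PI; apply: H => // p /PI /cset_subP[] //.
elim/Pfamily_ind : famP b => [b Ib _ _|{}P p pP famP _ lep IH b Ib PI Pb].
  by rewrite big_seq_fset0 subr_ge0 ndW //; move/csetP: Ib => /andP[].
have /PI sub : p \in (p |` P)%fset by rewrite fset1U1.
have Pp : cmax p.1 <= b by rewrite Pb ?fset1U1.
rewrite sum_fsetU1 // /incr.
have h1 : \sum_(p <- P) incr W p.1 <= W (cmin p.1) - W (cmin I).
  apply: IH => //; first by apply: sub; exact: cset_min.
  by move=> q qP; apply: PI; rewrite fset1Ur.
have h2 : W (cmax p.1) <= W b by apply: ndW => //; apply: sub; exact: cset_max.
by rewrite /incr in h1; lra.
Qed.

(** Divisions of the possibly degenerate interval from x to y; degenerate
    intervals have the empty division, so that divisions always concatenate. *)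
Definition divides x y P : Prop :=
  [/\ Pfamily P, forall p, p \in P -> x <= cmin p.1 /\ cmax p.1 <= y
    & forall z, x < z < y -> exists2 p, p \in P & cset p.1 z].

(** The rightmost cell of a division ends at y, and removing it leaves a
    division of what lies to its left. *)
Lemma divides_rect (H : R -> {fset cell R * R} -> Prop) x :
  H x fset0 ->
  (forall y P p, x <= y -> p \notin P -> cmin p.1 = y -> divides x y P ->
     H y P -> H (cmax p.1) (p |` P)%fset) ->
  forall y P, x <= y -> divides x y P -> H y P.
Proof.
move=> H0 HS y P xy [famP]; elim/Pfamily_ind: famP y xy.
  move=> y xy _ cov; have [<-//|yx] := eqVneq x y.
  have [|p] := cov ((x + y) / 2); last by rewrite inE.
  have : x < y by rewrite lt_neqAle yx.
  by move=> ?; apply/andP; split; lra.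
move=> {}P p pP famP pp lep IH y xy inP cov.
have [xp py] : x <= cmin p.1 /\ cmax p.1 <= y by apply: inP; rewrite fset1U1.
have ltp := cmin_lt p.1.
have yE : y = cmax p.1.
  apply/eqP; rewrite eq_le py andbT leNgt; apply/negP => lty.
  have [|q] := cov ((cmax p.1 + y) / 2); first by apply/andP; split; lra.
  rewrite in_fset1U => /orP[/eqP->/csetP/andP[_ ?]|qP /csetP/andP[_ ?]].
    by lra.
  by have := lep q qP; lra.
have div : divides x (cmin p.1) P.
  split=> // [q qP|z /andP[xz zp]].
    have [? _] : x <= cmin q.1 /\ cmax q.1 <= y.
      by apply: inP; rewrite fset1Ur.
    by split=> //; exact: lep.
  have [|q + qz] := cov z; first by rewrite xz yE (lt_trans zp).
  rewrite in_fset1U => /orP[/eqP qp|qP]; last by exists q.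
  by move: qz; rewrite qp => /csetP/andP[? _]; lra.
rewrite yE; apply: (HS (cmin p.1)) => //.
by case: div => _ inP' cov'; apply: IH.
Qed.

Lemma divides_telescope F x y P : x <= y -> divides x y P ->
  \sum_(p <- P) incr F p.1 = F y - F x.
Proof.
move: y P; apply: divides_rect => [|y P p xy pP py _ IH].
  by rewrite big_seq_fset0 subrr.
by rewrite sum_fsetU1 // IH /incr py; ring.
Qed.

(** Covering the interior is enough: the end points then belong to the extreme
    cells, so that the definition above agrees with that of a division. *)
Lemma divides_cover x y P z : x < y -> divides x y P -> x <= z <= y ->
  exists2 p, p \in P & cset p.1 z.
Proof.
move=> lt_xy div; have le_xy := ltW lt_xy; move: y P le_xy div lt_xy z.
apply: (@divides_rect (fun y P => x < y -> forall z, x <= z <= y ->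
  exists2 p, p \in P & cset p.1 z)) => [|{}y {}P p xy pP py _ IH _ z /andP[xz zp]].
  by rewrite ltxx.
have [zy|yz] := ltP z y.
  have [||q qP qz] := IH _ z; [exact: le_lt_trans zy|by rewrite xz ltW|].
  by exists q => //; rewrite fset1Ur.
by exists p; rewrite ?fset1U1 //; apply/csetP; rewrite py yz zp.
Qed.

Lemma PdivisionP I P : Pdivision I P <-> divides (cmin I) (cmax I) P.
Proof.
have ltI := cmin_lt I; split=> [[famP covP]|div].
  have sub p : p \in P -> cset p.1 `<=` cset I.
    by move=> pP x px; rewrite -covP; exists p.
  split=> // [p /sub /cset_subP //|z /andP[z1 z2]].
  have : cset I z by apply/csetP; rewrite !ltW.
  by rewrite -covP => -[p /= pP pz]; exists p.
have [famP inP _] := div; split=> //; apply/seteqP; split.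
  by move=> x [p /= /inP/cset_subP]; exact.
move=> x /csetP xI; have [p pP px] := divides_cover ltI div xI.
by exists p.
Qed.

Lemma divides_cat x y z P Q : x <= y -> y <= z -> divides x y P ->
  divides y z Q -> divides x z (P `|` Q)%fset /\ [disjoint P & Q]%fset.
Proof.
move=> xy yz [[tagP nonP] inP covP] [[tagQ nonQ] inQ covQ].
have le p q : p \in P -> q \in Q -> cmax p.1 <= cmin q.1.
  by move=> /inP[_ +] /inQ[+ _]; exact: le_trans.
split; last first.
  apply/fdisjointP => p pP; apply/negP => pQ.
  by have := le _ _ pP pQ; rewrite leNgt cmin_lt.
split.
- split=> [p|p q]; rewrite !in_fsetU.
    by case/orP; [exact: tagP|exact: tagQ].
  case/orP=> [pP|pQ] /orP[qP|qQ] pq.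
  + exact: nonP.
  + by apply/nonoverlappingP; left; exact: le.
  + by apply/nonoverlappingP; right; exact: le.
  + exact: nonQ.
- move=> p; rewrite in_fsetU => /orP[/inP[? ?]|/inQ[? ?]].
    by split=> //; exact: le_trans yz.
  by split=> //; exact: le_trans xy _.
- move=> t /andP[xt tz]; have [ty|yt] := leP t y; last first.
    have [|q qQ qt] := covQ t; first by rewrite yt.
    by exists q => //; rewrite in_fsetU qQ orbT.
  have [ty'|yt] := ltP t y.
    have [|q qP qt] := covP t; first by rewrite xt.
    by exists q => //; rewrite in_fsetU qP.
  have {ty yt} tE : t = y by apply/eqP; rewrite eq_le ty yt.
  have [|||p pP pt] := @divides_cover x y P t.
  + by rewrite -tE.
  + by split.
  + by rewrite tE xy lexx.
  by exists p => //; rewrite in_fsetU pP.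
Qed.

Lemma divides0 x : divides x x fset0.
Proof.
split=> [|p|z /andP[xz zx]]; [|by rewrite inE|].
  by split=> [p|p q]; rewrite inE.
by have := lt_trans xz zx; rewrite ltxx.
Qed.

Lemma divides1 J t : cset J t -> divides (cmin J) (cmax J) [fset (J, t)]%fset.
Proof.
move=> Jt; split=> [|p|z /andP[z1 z2]].
- split=> [p|p q]; rewrite !inE => /eqP->//.
  by move=> /eqP ->.
- by rewrite inE => /eqP->.
- by exists (J, t); rewrite ?inE //; apply/csetP; rewrite !ltW.
Qed.

End Cells.

(** * Fine sums and the Saks-Henstock lemma *)

Section Henstock.
Context {R : realType}.
Implicit Types (I J K : cell R) (P Q : {fset cell R * R}) (f d F W : R -> R).
Implicit Types (E : set R) (q : cell R -> R -> R).

Lemma gauge_onS I J d : cset J `<=` cset I -> gauge_on I d -> gauge_on J d.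
Proof. by move=> JI dI x /JI; exact: dI. Qed.

Lemma gauge_min I d1 d2 : gauge_on I d1 -> gauge_on I d2 ->
  gauge_on I (fun x => Num.min (d1 x) (d2 x)).
Proof. by move=> g1 g2 x Ix; rewrite lt_min g1 // g2. Qed.

Lemma fine_for_le d1 d2 P : (forall x, d1 x <= d2 x) ->
  fine_for d1 P -> fine_for d2 P.
Proof.
move=> d12 fP p pP x /(fP p pP) /=; rewrite !in_itv /= => /andP[h1 h2].
by have h3 := d12 p.2; apply/andP; split; lra.
Qed.

Lemma fine_for_minl d1 d2 P :
  fine_for (fun x => Num.min (d1 x) (d2 x)) P -> fine_for d1 P.
Proof. by apply: fine_for_le => x; rewrite ge_min lexx. Qed.

Lemma fine_for_minr d1 d2 P :
  fine_for (fun x => Num.min (d1 x) (d2 x)) P -> fine_for d2 P.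
Proof. by apply: fine_for_le => x; rewrite ge_min lexx orbT. Qed.

(** The set of Riemann sums of f over the d-fine divisions of the interval from
    x to y; it is additive in the interval. *)
Definition fine_sum f d x y : set R :=
  [set s | exists P, [/\ divides x y P, fine_for d P & KHsum f P = s]].

Lemma fine_sum_min f d1 d2 x y s :
  fine_sum f (fun z => Num.min (d1 z) (d2 z)) x y s ->
  fine_sum f d1 x y s /\ fine_sum f d2 x y s.
Proof.
by move=> [P [dP fP sP]]; split; exists P; split=> //;
   [exact: fine_for_minl fP|exact: fine_for_minr fP].
Qed.

Lemma fine_sum0 f d x : fine_sum f d x x 0.
Proof.
exists fset0; split; first exact: divides0; last by rewrite /KHsum big_seq_fset0.
by move=> p; rewrite inE.
Qed.

Lemma fine_sum_cat f d x y z s t : x <= y -> y <= z ->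
  fine_sum f d x y s -> fine_sum f d y z t -> fine_sum f d x z (s + t).
Proof.
move=> xy yz [P [dP fP <-]] [Q [dQ fQ <-]].
have [dPQ PQ] := divides_cat xy yz dP dQ.
exists (P `|` Q)%fset; split=> //.
  by move=> p; rewrite in_fsetU => /orP[]; [exact: fP|exact: fQ].
rewrite /KHsum (big_fsetID _ (mem P)) /=; congr (_ + _).
  by apply: eq_fbigl => p; rewrite !inE /=; case: (p \in P); rewrite ?andbF.
apply: eq_fbigl => p; rewrite !inE /=.
by have [pP|] := boolP (p \in P); rewrite ?andbT // (negPf (fdisjointP PQ _ pP)).
Qed.

Lemma fine_sum_tag f d J t : cset J t -> cset J `<=` `[t - d t, t + d t] ->
  fine_sum f d (cmin J) (cmax J) (f t * clen J).
Proof.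
move=> Jt fJ; exists [fset (J, t)]%fset; split; first exact: divides1.
  by move=> p; rewrite inE => /eqP->.
by rewrite /KHsum big_seq_fset1.
Qed.

(** Cousin's lemma, by the supremum of the points up to which a fine division
    exists: a fine cell tagged at that supremum reaches past it. *)
Lemma fine_sum_nonempty f d x y : x <= y ->
  (forall z, x <= z <= y -> 0 < d z) -> exists s, fine_sum f d x y s.
Proof.
move=> xy dpos; pose A := [set z | x <= z <= y /\ exists s, fine_sum f d x z s].
have Ax : A x by split; [rewrite lexx xy | exists 0; exact: fine_sum0].
have step c u v s : x <= u -> u <= c <= v -> v <= y -> u < v ->
    fine_sum f d x u s -> c - d c <= u -> v <= c + d c -> A v.
  move=> xu /andP[uc cv] vy uv sxu h1 h2.
  have uv' : (u, v).1 < (u, v).2 by [].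
  pose J := Cell uv'; split; first by apply/andP; split; lra.
  exists (s + f c * clen J); apply: fine_sum_cat xu (ltW uv) sxu _.
  apply: (@fine_sum_tag f d J); first by apply/csetP; apply/andP.
  move=> z /csetP /=; rewrite cminE cmaxE in_itv /= => /andP[? ?].
  by apply/andP; split; lra.
have supA : has_sup A.
  by split; [exists x | exists y => z [/andP[]]].
set c := sup A.
have xc : x <= c by apply: sup_upper_bound.
have cy : c <= y by apply: ge_sup; [exists x | move=> z [/andP[]]].
have dc : 0 < d c by apply: dpos; rewrite xc cy.
have [u Au uc] := sup_adherent dc supA.
have [/andP[xu uy] [s sxu]] := Au.
have uc' : u <= c by apply: sup_upper_bound.
have Ac : A c.
  have [<-//|uc0] := eqVneq u c.
  apply: (step c u c s) => //; rewrite ?lexx ?uc' //.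
  - by rewrite lt_neqAle uc0.
  - exact: ltW.
  - by rewrite lerDl ltW.
have [yc|] := leP y c.
  by have -> : y = c; [apply/eqP; rewrite eq_le yc cy|case: Ac].
move=> lt_cy; have [/andP[_ _] [s' sxc]] := Ac.
pose v := Num.min y (c + d c).
have cv : c < v by rewrite lt_min lt_cy ltrDl.
have Av : A v.
  apply: (step c c v s') => //; rewrite ?lexx ?(ltW cv) //.
  - by rewrite ge_min lexx.
  - by rewrite gerBl ltW.
  - by rewrite ge_min lexx orbT.
by have := sup_upper_bound supA Av; rewrite leNgt cv.
Qed.

(** Bounding the sums of q over all fine families tagged in E; every
    almost-everywhere argument about primitives goes through this notion. *)
Definition negl_var I E q : Prop := forall e, 0 < e ->
  exists2 d, gauge_on I d & forall P, Pfamily P -> fine_for d P ->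
    (forall p, p \in P -> cset p.1 `<=` cset I) ->
    (forall p, p \in P -> E p.2) -> \sum_(p <- P) q p.1 p.2 <= e.

(** The Saks-Henstock lemma turned into a definition: F is a
    Kurzweil-Henstock primitive of f on I. *)
Definition primitive I f F : Prop :=
  negl_var I setT (fun J t => `|f t * clen J - incr F J|).

Lemma is_KHint_unique I f r s : is_KHint I f r -> is_KHint I f s -> r = s.
Proof.
move=> fr fs; apply/eqP; rewrite -subr_eq0 -normr_le0; apply/ler_addgt0Pr => e e0.
have e2 : 0 < e / 2 by lra.
have [d1 g1 H1] := fr _ e2; have [d2 g2 H2] := fs _ e2.
have [||u] := @fine_sum_nonempty f (fun x => Num.min (d1 x) (d2 x)) (cmin I) (cmax I).
- by rewrite ltW // cmin_lt.
- by move=> z /csetP; exact: (gauge_min g1 g2).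
move=> [P [/PdivisionP dP fP uE]].
have h1 := H1 P dP (fine_for_minl fP); have h2 := H2 P dP (fine_for_minr fP).
have -> : r - s = (KHsum f P - s) - (KHsum f P - r) by ring.
by rewrite add0r; have := ler_normB (KHsum f P - s) (KHsum f P - r); lra.
Qed.

Lemma is_KHintE I f r : is_KHint I f r -> KHint I f = r.
Proof.
by move=> fr; apply: xget_unique => // s fs; exact: is_KHint_unique fs fr.
Qed.

(** Along a division the increments of F telescope. *)
Lemma primitive_is_KHint I f F J : primitive I f F -> cset J `<=` cset I ->
  is_KHint J f (incr F J).
Proof.
move=> fF JI e e0; have e2 : 0 < e / 2 by lra.
have [d gd H] := fF _ e2; exists d; first exact: gauge_onS gd.
move=> P /PdivisionP dP fP; have [famP inP _] := dP.
have := divides_telescope F (ltW (cmin_lt J)) dP.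
rewrite -/(incr F J) => <-; rewrite /KHsum -sumrB.
apply: le_lt_trans (ler_norm_sum _ _ _) _.
apply: (@le_lt_trans _ _ (e / 2)); last by lra.
apply: H => // p pP; apply: subset_trans JI.
by apply/cset_subP; exact: inP.
Qed.

Lemma primitive_KHint I f F J : primitive I f F -> cset J `<=` cset I ->
  KHint J f = incr F J.
Proof. by move=> fF JI; apply: is_KHintE; exact: primitive_is_KHint JI. Qed.

Lemma primitive_KH I f F : primitive I f F -> f \in KH I.
Proof.
by move=> fF; apply/asboolP; exists (incr F I); exact: primitive_is_KHint fF (@subset_refl _ _).
Qed.

(** Cauchy's condition for the precision e. It passes to subintervals, since
    fine sums there extend by common fine sums on both sides. *)
Definition good I f (e : R) d :=
  gauge_on I d /\ forall s t, fine_sum f d (cmin I) (cmax I) s ->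
    fine_sum f d (cmin I) (cmax I) t -> s - t <= e.

Lemma good_exists I f r e : is_KHint I f r -> 0 < e -> exists d, good I f e d.
Proof.
move=> fr e0; have e2 : 0 < e / 2 by lra.
have [d gd H] := fr _ e2; exists d; split=> // s t [P [dP fP <-]] [Q [dQ fQ <-]].
have := H P ((PdivisionP _ _).2 dP) fP.
have := H Q ((PdivisionP _ _).2 dQ) fQ.
by rewrite !ltr_norml => /andP[? ?] /andP[? ?]; lra.
Qed.

Lemma good_sub I f e d x y s t : good I f e d -> cset I x -> cset I y -> x <= y ->
  fine_sum f d x y s -> fine_sum f d x y t -> s - t <= e.
Proof.
move=> [gd H] Ix Iy xy sxy txy.
move: (Ix) (Iy) => /csetP/andP[ax xb] /csetP/andP[ay yb].
have pos u v : cset I u -> cset I v -> forall z, u <= z <= v -> 0 < d z.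
  move=> /csetP/andP[? _] /csetP/andP[_ ?] z /andP[? ?]; apply: gd.
  by apply/csetP; apply/andP; split; lra.
have [u ua] := fine_sum_nonempty f ax (pos _ _ (cset_min I) Ix).
have [v vb] := fine_sum_nonempty f yb (pos _ _ Iy (cset_max I)).
have cat w : fine_sum f d x y w -> fine_sum f d (cmin I) (cmax I) (u + w + v).
  by move=> wxy; apply: fine_sum_cat ay yb _ vb; exact: fine_sum_cat ax xy ua wxy.
by have := H _ _ (cat _ sxy) (cat _ txy); lra.
Qed.

Let pos_on I d x y z : gauge_on I d -> cset I x -> cset I y -> x <= z <= y -> 0 < d z.
Proof.
move=> gd /csetP/andP[? _] /csetP/andP[_ ?] /andP[? ?]; apply: gd.
by apply/csetP; apply/andP; split; lra.
Qed.

Lemma sub_limit I f r x y : is_KHint I f r -> cset I x -> cset I y -> x <= y ->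
  exists l, forall e d s, good I f e d -> fine_sum f d x y s -> `|s - l| <= e.
Proof.
move=> fr Ix Iy xy.
pose A := [set u | exists2 d, gauge_on I d & forall s, fine_sum f d x y s -> s <= u].
(* the upper integral: the least asymptotic upper bound of the fine sums *)
exists (inf A) => e d s gd sxy.
have As : A (s + e).
  exists d; first by case: gd.
  by move=> t txy; have := good_sub gd Ix Iy xy txy sxy; lra.
have lbA : lbound A (s - e).
  move=> u [d' gd' ub].
  have [|t tm] := @fine_sum_nonempty f (fun z => Num.min (d z) (d' z)) x y xy.
    by move=> z; exact: pos_on (gauge_min gd.1 gd') Ix Iy.
  have [t1 /ub t2] := fine_sum_min tm.
  by have := good_sub gd Ix Iy xy sxy t1; lra.
have : inf A <= s + e by apply: ge_inf => //; exists (s - e).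
have : s - e <= inf A by apply: lb_le_inf => //; exists (s + e).
by rewrite ler_norml => ? ?; apply/andP; split; lra.
Qed.

(** The Saks-Henstock lemma. For a gauge whose fine sums over I differ by at
    most e, let W x be the supremum of the differences of two fine sums over the
    cell from min I to x. It is nondecreasing with total increment at most e, and
    its increment over a fine tagged cell bounds the error made there. *)
Lemma is_KHint_primitive I f r : is_KHint I f r -> exists F, primitive I f F.
Proof.
move=> fr; have ltI := cmin_lt I; set a := cmin I.
have Ia : cset I a := cset_min I.
have /choice[F HF] : forall x, exists l, cset I x -> forall e d s,
    good I f e d -> fine_sum f d a x s -> `|s - l| <= e.
  move=> x; have [Ix|nIx] := pselect (cset I x); last by exists 0.
  have /csetP/andP[ax _] := Ix.
  by have [l Hl] := sub_limit fr Ia Ix ax; exists l.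
have F_lim x y e d s : cset I x -> cset I y -> x <= y -> good I f e d ->
    fine_sum f d x y s -> `|s - (F y - F x)| <= e *+ 2.
  move=> Ix Iy xy gd sxy; have /csetP/andP[ax _] := Ix.
  have [|u uax] := @fine_sum_nonempty f d a x ax.
    by move=> z; exact: pos_on gd.1 _ _.
  have h1 := HF x Ix _ _ _ gd uax.
  have h2 := HF y Iy _ _ _ gd (fine_sum_cat ax xy uax sxy).
  by move: h1 h2; rewrite !ler_norml mulr2n => /andP[? ?] /andP[? ?]; apply/andP; split; lra.
exists F => e e0; have [d gd] := good_exists fr e0.
exists d; first by case: gd.
move=> P famP fP PI _.
pose D x := [set w | exists u v, [/\ fine_sum f d a x u, fine_sum f d a x v & w = u - v]].
pose W x := sup (D x).
have D0 x : cset I x -> D x !=set0.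
  move=> Ix; have /csetP/andP[ax _] := Ix.
  have [|u uax] := @fine_sum_nonempty f d a x ax.
    by move=> z; exact: pos_on gd.1 _ _.
  by exists (u - u), u, u.
have De x : cset I x -> ubound (D x) e.
  move=> Ix w [u [v [ux vx ->]]]; have /csetP/andP[ax _] := Ix.
  exact: good_sub gd Ia Ix ax ux vx.
have supD x : cset I x -> has_sup (D x).
  by move=> Ix; split; [exact: D0|exists e; exact: De].
have Wstep x y s t : cset I x -> cset I y -> x <= y ->
    fine_sum f d x y s -> fine_sum f d x y t -> s - t <= W y - W x.
  move=> Ix Iy xy sxy txy; have /csetP/andP[ax _] := Ix.
  suff : W x <= W y - (s - t) by lra.
  apply: ge_sup; first exact: D0.
  move=> w [u [v [ux vx ->]]].
  have : D y ((u + s) - (v + t)).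
    by exists (u + s), (v + t); split=> //; apply: fine_sum_cat ax xy _ _.
  by move=> /(sup_upper_bound (supD y Iy)); rewrite -/(W y); lra.
have Wnd x y : cset I x -> cset I y -> x <= y -> W x <= W y.
  move=> Ix Iy xy; have [|s sxy] := @fine_sum_nonempty f d x y xy.
    by move=> z; exact: pos_on gd.1 _ _.
  by have := Wstep x y s s Ix Iy xy sxy sxy; lra.
apply: (@le_trans _ _ (\sum_(p <- P) incr W p.1)).
  rewrite big_seq [leRHS]big_seq; apply: ler_sum => -[J t] /= pP.
  have JI : cset J `<=` cset I := PI _ pP.
  have Jx : cset I (cmin J) by apply: JI; exact: cset_min.
  have Jy : cset I (cmax J) by apply: JI; exact: cset_max.
  have xy := ltW (cmin_lt J).
  have sJ : fine_sum f d (cmin J) (cmax J) (f t * clen J).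
    by apply: fine_sum_tag; [case: famP => /(_ _ pP)|exact: fP pP].
  apply/ler_addgt0Pr => e' e'0; have e2 : 0 < e' / 2 by lra.
  (* a sum s that is fine for both gauges is compared with the error through
     W and with the increment of F up to e' *)
  have [d' gd'] := good_exists fr e2.
  pose dd z := Num.min (d z) (d' z).
  have [|s ss] := @fine_sum_nonempty f dd (cmin J) (cmax J) xy.
    by move=> z; exact: pos_on (gauge_min gd.1 gd'.1) Jx Jy.
  have [s1 s2] := fine_sum_min ss.
  have := F_lim _ _ _ _ _ Jx Jy xy gd' s2.
  have := Wstep _ _ _ _ Jx Jy xy sJ s1; have := Wstep _ _ _ _ Jx Jy xy s1 sJ.
  rewrite /incr !ler_norml mulr2n => ? ? /andP[? ?]; apply/andP; split; lra.
apply: le_trans (sum_incr_le famP Wnd PI) _; rewrite /incr.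
have : W (cmax I) <= e by apply: ge_sup; [exact/D0/cset_max|exact/De/cset_max].
have : 0 <= W (cmin I).
  apply: sup_upper_bound; first exact: supD.
  by exists 0, 0; split; rewrite ?subrr //; exact: fine_sum0.
by lra.
Qed.

Lemma KH_primitive I f : f \in KH I -> exists F, primitive I f F.
Proof. by move=> /asboolP[r]; exact: is_KHint_primitive. Qed.

End Henstock.

(** * Families of negligible variation *)

Section NegligibleVariation.
Context {R : realType}.
Implicit Types (I J K : cell R) (P Q : {fset cell R * R}) (f g d F W w : R -> R).
Implicit Types (E : set R) (q : cell R -> R -> R).

Lemma negl_var_le I E E' q q' : negl_var I E' q' -> E `<=` E' ->
  (forall J t, cset J `<=` cset I -> cset J t -> E t -> q J t <= q' J t) ->
  negl_var I E q.
Proof.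
move=> H EE' qq' e e0; have [d gd Hd] := H e e0; exists d => // P famP fP PI PE.
apply: le_trans (Hd P famP fP PI _); last by move=> p /PE /EE'.
rewrite big_seq [leRHS]big_seq; apply: ler_sum => p pP.
by apply: qq'; [exact: PI|case: famP => /(_ _ pP)|exact: PE].
Qed.

Lemma negl_varD I E q q' : negl_var I E q -> negl_var I E q' ->
  negl_var I E (fun J t => q J t + q' J t).
Proof.
move=> H H' e e0; have e2 : 0 < e / 2 by lra.
have [d gd Hd] := H _ e2; have [d' gd' Hd'] := H' _ e2.
exists (fun x => Num.min (d x) (d' x)); first exact: gauge_min.
move=> P famP fP PI PE; rewrite big_split /=.
have := Hd P famP (fine_for_minl fP) PI PE.
by have := Hd' P famP (fine_for_minr fP) PI PE; lra.
Qed.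

Lemma negl_varZ I E q (c : R) : 0 <= c -> negl_var I E q ->
  negl_var I E (fun J t => c * q J t).
Proof.
move=> c0 H e e0; have c1 : 0 < c + 1 by lra.
have [d gd Hd] := H _ (divr_gt0 e0 c1); exists d => // P famP fP PI PE.
rewrite -mulr_sumr; have := Hd P famP fP PI PE.
rewrite ler_pdivlMr // => Hs; have [s0|/ltW s0] := leP 0 (\sum_(p <- P) q p.1 p.2).
  by apply: le_trans Hs; rewrite mulrC ler_wpM2l //; lra.
by apply: le_trans (ltW e0); rewrite mulr_ge0_le0.
Qed.

Lemma Pfamily_filter P (b : pred (cell R * R)) : Pfamily P ->
  Pfamily [fset p in P | b p]%fset.
Proof. by apply: PfamilyS => p; rewrite !inE /= => /andP[]. Qed.

(** The tags in the n-th set get the gauge for the precision e / 2 ^ n.+1. *)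
Lemma negl_var_bigcup I (E : (set R)^nat) q : (forall J t, 0 <= q J t) ->
  (forall n, negl_var I (E n) q) -> negl_var I (\bigcup_n E n) q.
Proof.
move=> q0 H e e0; have en n : 0 < e / 2 ^+ n.+1 by rewrite divr_gt0 ?exprn_gt0.
have /choice[d Hd] : forall n, exists d, gauge_on I d /\
    forall P, Pfamily P -> fine_for d P ->
    (forall p, p \in P -> cset p.1 `<=` cset I) ->
    (forall p, p \in P -> E n p.2) -> \sum_(p <- P) q p.1 p.2 <= e / 2 ^+ n.+1.
  by move=> n; have [d ? ?] := H n _ (en n); exists d.
(* any choice of a set containing the tag will do *)
pose k t := xget 0%N [set n | E n t].
exists (fun t => d (k t) t) => [t It|P famP fP PI PE].
  by have [gd _] := Hd (k t); exact: gd.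
have kE p : p \in P -> E (k p.2) p.2.
  by move=> /PE [n _ Hn]; rewrite /k; case: xgetP => [m _ //|/(_ n)].
have step n : \sum_(p <- P | k p.2 == n) q p.1 p.2 <= e / 2 ^+ n.+1.
  rewrite big_fset_condE; have [_ HP] := Hd n; apply: HP.
  - exact: Pfamily_filter.
  - move=> p; rewrite !inE /= => /andP[pP /eqP <-] x.
    exact: fP pP x.
  - by move=> p; rewrite !inE /= => /andP[pP _]; exact: PI.
  - by move=> p; rewrite !inE /= => /andP[pP /eqP <-]; exact: kE.
have partial N : \sum_(p <- P | (k p.2 < N)%N) q p.1 p.2 <= e - e / 2 ^+ N.
  elim: N => [|N IH]; first by rewrite big1 ?expr0 ?divr1 ?subrr.
  rewrite (bigID (fun p => k p.2 == N)) /=.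
  rewrite (eq_bigl (fun p => k p.2 == N)); last first.
    by move=> p; case: eqP => [->|]; rewrite ?andbF // ltnSn.
  rewrite [X in _ + X <= _](eq_bigl (fun p => (k p.2 < N)%N)); last first.
    by move=> p; rewrite ltnS ltn_neqAle andbC.
  have := step N; rewrite exprS invfM.
  by have -> : e * (2^-1 * 2 ^- N) = e / 2 ^+ N / 2; [ring|lra].
pose N := (\max_(p <- P) k p.2).+1.
have := partial N; rewrite big_seq_cond (eq_bigl (fun p => p \in P)); last first.
  move=> p; case: (boolP (p \in P)) => //= pP.
  by rewrite ltnS; apply: (@leq_bigmax_seq _ _ _ (fun p => k p.2)).
rewrite -big_seq => /le_trans; apply.
by rewrite gerBl divr_ge0 ?exprn_ge0 // ltW.
Qed.

(** On the set where the weight is at most n this is scaling by n, and these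
    sets exhaust E. *)
Lemma negl_var_weight I E q w : (forall J t, 0 <= q J t) ->
  negl_var I E q -> negl_var I E (fun J t => `|w t| * q J t).
Proof.
move=> q0 H; pose En n : set R := [set t | E t /\ `|w t| <= n%:R].
apply: (@negl_var_le _ _ (\bigcup_n En n) _ (fun J t => `|w t| * q J t)) => //.
- apply: negl_var_bigcup => [J t|n]; first by rewrite mulr_ge0.
  have H' := negl_varZ (ler0n R n) H.
  apply: negl_var_le H' _ _ => [t []//|J t _ _ [_ wn]].
  by rewrite ler_wpM2r.
- move=> t Et; exists (Num.truncn `|w t|).+1 => //; split=> //.
  by rewrite ltW // truncnS_gt.
Qed.

Lemma negl_varU I E E' q : (forall J t, 0 <= q J t) ->
  negl_var I E q -> negl_var I E' q -> negl_var I (E `|` E') q.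
Proof.
move=> q0 H H'; pose En n := if n == 0%N then E else E'.
apply: (@negl_var_le _ _ (\bigcup_n En n) _ q) => //; last first.
  by move=> t [Et|Et]; [exists 0%N|exists 1%N].
by apply: negl_var_bigcup => // -[|n].
Qed.

Lemma sum_clen_le I P : Pfamily P -> (forall p, p \in P -> cset p.1 `<=` cset I) ->
  \sum_(p <- P) clen p.1 <= clen I.
Proof. by move=> famP PI; apply: (@sum_incr_le R I id). Qed.

Lemma is_derive_increment F (t l : R) : is_derive t (1 : R) F l ->
  forall e, 0 < e -> exists2 d, 0 < d &
    forall x, `|x - t| <= d -> `|F x - F t - l * (x - t)| <= e * `|x - t|.
Proof.
move=> [dF dFl] e e0; move: dF => /cvg_ex[/= l' Hl'].
have El : l' = l by rewrite -dFl; apply/esym/cvg_lim.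
rewrite {l'}El in Hl'.
have /cvgrPdist_le /(_ e e0) : h^-1 *: (F (h *: (1 : R) + t) - F t) @[h --> 0^'] --> l.
  exact: Hl'.
move=> /nbhs_ballP[d /= d0 Hd]; exists (d / 2); first by lra.
move=> x xt; have [->|xt0] := eqVneq x t; first by rewrite !subrr mulr0 subrr normr0 mulr0.
have := Hd (x - t); rewrite /ball /= sub0r normrN => /(_ _ _).
rewrite subr_eq0 => /(_ _ xt0); rewrite [_%:A]mulr1 subrK.
have xtd : `|x - t| < d by lra.
move=> /(_ xtd) H.
have x0 : x - t != 0 by rewrite subr_eq0.
have -> : F x - F t - l * (x - t) = - (l - (x - t)^-1 * (F x - F t)) * (x - t).
  by field.
by rewrite normrM normrN ler_wpM2r.
Qed.

(** The straddle lemma: near a point of differentiability, increments over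
    cells containing the point are linear up to a small multiple of the length. *)
Lemma negl_var_derive I F g : negl_var I [set t : R | is_derive t (1 : R) F (g t)]
  (fun J t => `|g t * clen J - incr F J|).
Proof.
have lenI : 0 < clen I by rewrite subr_gt0 cmin_lt.
move=> e e0; pose e' := e / clen I; have e'0 : 0 < e' by exact: divr_gt0.
have /choice[d Hd] : forall t : R, exists r, is_derive t (1 : R) F (g t) -> 0 < r /\
    forall x, `|x - t| <= r -> `|F x - F t - g t * (x - t)| <= e' * `|x - t|.
  move=> t; have [dt|] := pselect (is_derive t (1 : R) F (g t)); last by exists 0.
  by have [d d0 H] := is_derive_increment dt e'0; exists d.
exists (fun t => if 0 < d t then d t else 1) => [t _|P famP fP PI PE].
  by case: ifP.
apply: (@le_trans _ _ (\sum_(p <- P) e' * clen p.1)); last first.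
  rewrite -mulr_sumr; apply: (@le_trans _ _ (e' * clen I)).
    by apply: ler_wpM2l; [exact: ltW|exact: sum_clen_le].
  by rewrite /e' divfK // gt_eqF.
rewrite big_seq [leRHS]big_seq; apply: ler_sum => -[J t] /= pP.
have /= dt := PE _ pP; have [dt0 Hdt] := Hd t dt.
have /csetP /andP[/= Jt tJ] : cset (J, t).1 (J, t).2 by case: famP => /(_ _ pP).
have near x : cset J x -> `|x - t| <= d t.
  move=> /(fP _ pP) /=; rewrite dt0 in_itv /= => /andP[h1 h2].
  by rewrite ler_norml; apply/andP; split; lra.
have := Hdt _ (near _ (cset_max J)); rewrite (ger0_norm (_ : 0 <= cmax J - t)) ?subr_ge0 //.
have := Hdt _ (near _ (cset_min J)); rewrite (ler0_norm (_ : cmin J - t <= 0)) ?subr_le0 //.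
rewrite /incr /clen !ler_norml => /andP[? ?] /andP[? ?].
by apply/andP; split; nra.
Qed.

Lemma primitive_derive I F g : (forall t : R, is_derive t (1 : R) F (g t)) -> primitive I g F.
Proof. by move=> H; apply: negl_var_le (@negl_var_derive I F g) _ _ => // t _; exact: H. Qed.

Lemma primitive_id I : primitive I (cst 1) (fun y => y - cmin I).
Proof.
apply: primitive_derive => t.
by rewrite -[1 in X in is_derive _ _ _ X]subr0; apply: is_deriveB.
Qed.

Lemma primitiveD I f g F G : primitive I f F -> primitive I g G ->
  primitive I (f + g) (F + G).
Proof.
move=> fF gG; apply: negl_var_le (negl_varD fF gG) _ _ => // J t _ _ _.
apply: le_trans (ler_normD _ _); rewrite le_eqVlt; apply/orP; left.
by apply/eqP; congr `|_|; rewrite /incr !fctE; ring.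
Qed.

Lemma primitiveZ I f F (c : R) : primitive I f F -> primitive I (c *: f) (c *: F).
Proof.
move=> fF; apply: negl_var_le (negl_varZ (normr_ge0 c) fF) _ _ => // J t _ _ _.
rewrite -normrM le_eqVlt; apply/orP; left.
by apply/eqP; congr `|_|; rewrite /incr !scalrfctE /GRing.scale /=; ring.
Qed.

Lemma primitive_congr I f F G : (forall x, cset I x -> F x = G x) ->
  primitive I f F -> primitive I f G.
Proof.
move=> FG fF; apply: negl_var_le fF _ _ => // J t JI _ _.
by rewrite /incr !FG //; apply: JI; [exact: cset_min|exact: cset_max].
Qed.

Lemma primitive_incr_unique I f F G J : primitive I f F -> primitive I f G ->
  cset J `<=` cset I -> incr F J = incr G J.
Proof. by move=> fF fG JI; rewrite -(primitive_KHint fF JI) (primitive_KHint fG JI). Qed.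

(** Continuity of primitives: a single small cell with tag x is a fine family. *)
Lemma primitive_cvg I f F x : primitive I f F -> cset I x ->
  forall e, 0 < e -> exists2 d, 0 < d &
    forall y, cset I y -> `|y - x| < d -> `|F y - F x| <= e.
Proof.
move=> fF Ix e e0; have e2 : 0 < e / 2 by lra.
have [d gd H] := fF _ e2; have dx := gd x Ix.
have fx1 : 0 < `|f x| + 1 by rewrite ltr_wpDl.
pose d' := Num.min (d x) (e / 2 / (`|f x| + 1)).
exists d'; first by rewrite lt_min dx divr_gt0.
have main u v : u < v -> cset I u -> cset I v -> (x = u \/ x = v) -> v - u < d' ->
    `|F v - F u| <= e.
  move=> uv Iu Iv xuv vu; have uv' : (u, v).1 < (u, v).2 by [].
  pose J := Cell uv'.
  have Jx : cset J x by apply/csetP; rewrite cminE cmaxE; case: xuv => ->; rewrite lexx ltW.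
  have [famP _ _] := divides1 Jx.
  move: vu; rewrite /d' lt_min => /andP[vd vf].
  have fP : fine_for d [fset (J, x)]%fset.
    move=> p; rewrite inE => /eqP-> z /csetP /=.
    rewrite cminE cmaxE in_itv /= => /andP[? ?].
    by case: xuv => xE; rewrite xE in vd *; apply/andP; split; lra.
  have PI p : p \in [fset (J, x)]%fset -> cset p.1 `<=` cset I.
    rewrite inE => /eqP-> /=; apply/cset_subP.
    by move: Iu Iv => /csetP/andP[? ?] /csetP/andP[? ?].
  have := H _ famP fP PI (fun _ _ => Logic.I); rewrite big_seq_fset1 /=.
  rewrite /incr /clen cminE cmaxE => h1.
  have h2 : `|f x * (v - u)| <= e / 2.
    rewrite normrM (ger0_norm (_ : 0 <= v - u)) ?subr_ge0 ?ltW //.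
    move: vf; rewrite ltr_pdivlMr //; have := normr_ge0 (f x); nra.
  by move: h1 h2; rewrite !ler_norml => /andP[? ?] /andP[? ?]; apply/andP; split; lra.
move=> y Iy yx; have [xy|yx'|->] := ltgtP x y; last by rewrite subrr normr0 ltW.
- apply: main => //; first by left.
  by move: yx; rewrite gtr0_norm // subr_gt0.
- rewrite distrC; apply: main => //; first by right.
  by move: yx; rewrite distrC gtr0_norm // subr_gt0.
Qed.

End NegligibleVariation.

(** * Null sets and primitives *)

Section Measures.
Context {R : realType}.
Local Notation mu := (@lebesgue_measure R).
Implicit Types (I J K : cell R) (P Q : {fset cell R * R}) (f g d F W w : R -> R).
Implicit Types (E : set R) (q : cell R -> R -> R).
Implicit Type nu : {measure set (measurableTypeR R) -> \bar R}.

(** Half-open cells, which are disjoint when the cells do not overlap. *)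
Definition ocset J : set (measurableTypeR R) := `]cmin J, cmax J].

Lemma ocsetP J (x : R) : ocset J x <-> cmin J < x <= cmax J.
Proof. by rewrite /ocset /= in_itv. Qed.

Lemma measurable_ocset J : measurable (ocset J).
Proof. exact: measurable_itv. Qed.

Lemma mu_ocset J : mu (ocset J) = (clen J)%:E.
Proof. by rewrite /ocset lebesgue_measure_itv /= lte_fin cmin_lt. Qed.

Lemma Pfamily_trivIset P : Pfamily P -> trivIset [set` P] (fun p => ocset p.1).
Proof.
move=> [_ nonP]; apply/trivIsetP => p q /= pP qP /eqP pq.
apply/seteqP; split=> // x [/ocsetP/andP[? ?] /ocsetP/andP[? ?]] /=.
by have /nonoverlappingP := nonP p q pP qP pq; move: pq => _ [?|?]; lra.
Qed.

Lemma measure_family nu P : Pfamily P ->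
  nu (\bigcup_(p in [set` P]) ocset p.1) = (\sum_(p <- P) nu (ocset p.1))%E.
Proof.
move=> famP; rewrite bigcup_fset measure_fbigsetU //; last exact: Pfamily_trivIset.
by move=> p _; exact: measurable_ocset.
Qed.

Lemma measurable_family P :
  measurable (\bigcup_(p in [set` P]) ocset p.1 : set (measurableTypeR R)).
Proof.
by apply: fin_bigcup_measurable => [|p _]; [exact: finite_fset|exact: measurable_ocset].
Qed.

Lemma sum_clen_measure P : Pfamily P ->
  (\sum_(p <- P) clen p.1)%:E = mu (\bigcup_(p in [set` P]) ocset p.1).
Proof.
move=> famP; rewrite measure_family // -sumEFin.
by apply: eq_bigr => p _; apply/esym; exact: mu_ocset.
Qed.

Lemma ocset_cset J : ocset J `<=` cset J.
Proof. by move=> x /ocsetP/andP[h ?]; apply/csetP; rewrite ltW. Qed.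

(** Cells tagged in a null set and fine enough lie in an open set of small measure. *)
Lemma negl_var_null I E : mu.-negligible E -> negl_var I E (fun J _ => clen J).
Proof.
move=> [B [mB B0 EB]] e e0; have {}B0 : mu B = 0%E by exact: B0.
have muB : (mu B < +oo)%E by rewrite B0.
have [U [oU BU Ue]] := lebesgue_regularity_outer mB muB e0.
have mU : measurable (U : set (measurableTypeR R)) by exact: measurable_realfun.open_measurable.
have muU : (mu U <= e%:E)%E.
  have -> : U = B `|` (U `\` B) by rewrite setDUK.
  apply: le_trans (measureU2 _ _ _) _ => //; first exact: measurableD.
  by rewrite [X in (X + _)%E]B0 add0e ltW.
have /choice[d Hd] : forall t, exists r, 0 < r /\
    (U t -> forall x, `|x - t| <= r -> U x).
  move=> t; have [Ut|] := pselect (U t); last by exists 1.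
  have /nbhs_ballP[r /= r0 Hr] : nbhs t U by exact: open_nbhs_nbhs.
  exists (r / 2); split; first by lra.
  move=> _ x xt; apply: Hr; rewrite /ball /= distrC; apply: le_lt_trans xt _; lra.
exists d => [t _|P famP fP _ PE]; first by case: (Hd t).
rewrite -lee_fin sum_clen_measure //; apply: le_trans muU.
apply: le_measure; rewrite ?inE //; first exact: measurable_family.
move=> x [p /= pP /ocset_cset px].
have [_ +] := Hd p.2; apply; first by apply/BU/EB/PE.
have := fP p pP x px; rewrite /= in_itv /= => /andP[? ?].
by rewrite ler_norml; apply/andP; split; lra.
Qed.

(** Cut I into n+1 equal cells; the cells containing a point of E whose gauge
    exceeds their length form a fine family, hence have small total measure,
    and every point of E belongs to one of them for all large n. *)
Lemma negl_var_measure_le I E nu F e : 0 < e ->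
  (forall J, cset J `<=` cset I -> (nu (ocset J) <= (incr F J)%:E)%E) ->
  negl_var I E (fun J _ => incr F J) ->
  exists C : set (measurableTypeR R), [/\ measurable C, (nu C <= e%:E)%E &
    forall t, E t -> cmin I < t <= cmax I -> C t].
Proof.
move=> e0 nuF H; have [d gd Hd] := H e e0.
have ltI := cmin_lt I; have lenI : 0 < clen I by rewrite subr_gt0.
pose h n : R := clen I / n.+1%:R; have h0 n : 0 < h n by rewrite divr_gt0.
have hn n : h n * n.+1%:R = clen I by rewrite /h divfK.
pose pt n i : R := cmin I + h n * i%:R.
have ltpt n i : (pt n i, pt n i.+1).1 < (pt n i, pt n i.+1).2.
  by rewrite /= /pt -addn1 natrD mulrDr mulr1 addrA ltrDl.
pose G n i := Cell (ltpt n i).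
have Glen n i : cmax (G n i) - cmin (G n i) = h n.
  by rewrite cminE cmaxE /pt -addn1 natrD; ring.
have GI n i : (i < n.+1)%N -> cset (G n i) `<=` cset I.
  move=> iltn; apply/cset_subP; rewrite cminE cmaxE /pt; split.
    by rewrite lerDl mulr_ge0 // ltW.
  have -> : cmax I = cmin I + h n * n.+1%:R by rewrite hn /clen; ring.
  by rewrite lerD2l ler_wpM2l ?ler_nat // ltW.
pose sel n i t := [/\ cset (G n i) t, E t & h n <= d t].
have /choice[A HA] : forall n, exists C : set (measurableTypeR R),
    [/\ measurable C, (nu C <= e%:E)%E &
    forall t, E t -> cmin I < t <= cmax I -> h n <= d t -> C t].
  move=> n; pose tag i := xget 0 [set t | sel n i t].
  have tagP i t : sel n i t -> sel n i (tag i).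
    by move=> Ht; rewrite /tag; case: xgetP => [x _ //|/(_ t)].
  pose P := [fset (G n (val i), tag (val i)) | i in 'I_n.+1
               & `[< sel n (val i) (tag (val i)) >]]%fset.
  have PP p : p \in P -> exists i, [/\ (i < n.+1)%N, sel n i (tag i) & p = (G n i, tag i)].
    by case/imfsetP => /= i; rewrite inE /= => Hi ->; exists (val i); split=> //; exact: ltn_ord.
  have famP : Pfamily P.
    split=> [p /PP[i [_ [Gt _ _] ->]] //|p q /PP[i [_ _ ->]] /PP[j [_ _ ->]] ij].
    apply/nonoverlappingP => /=; rewrite !cminE !cmaxE /pt.
    have [ltij|ltji|eqij] := ltngtP i j; last by rewrite eqij in ij.
      by left; rewrite lerD2l ler_wpM2l ?ler_nat // ltW.
    by right; rewrite lerD2l ler_wpM2l ?ler_nat // ltW.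
  have PI p : p \in P -> cset p.1 `<=` cset I by case/PP => i [iltn _ ->]; exact: GI.
  exists (\bigcup_(p in [set` P]) ocset p.1); split.
  - exact: measurable_family.
  - rewrite measure_family //; apply: (@le_trans _ _ (\sum_(p <- P) incr F p.1)%:E).
      rewrite -sumEFin big_seq [leRHS]big_seq; apply: lee_sum => p pP.
      exact/nuF/PI.
    rewrite lee_fin; apply: Hd => // p /PP[i [iltn [Gt Et ht] ->]] //=.
    move=> x /csetP/andP[x1 x2]; move: Gt => /csetP/andP[t1 t2].
    have Gn := Glen n i; rewrite /= in_itv /=.
    by apply/andP; split; lra.
  - move=> t Et /andP[It tI] ht.
    have ex : exists k, t <= pt n k.
      by exists n.+1; rewrite /pt hn /clen addrC subrK.
    (* the least grid point not to the left of t ends the half-open cell of t *)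
    case: (ex_minnP ex) => -[|i] tk mink.
      by move: tk; rewrite /pt mulr0 addr0 leNgt It.
    have ti : pt n i < t.
      by rewrite ltNge; apply/negP => /mink; rewrite ltnn.
    have iltn : (i < n.+1)%N.
      by apply: mink; rewrite /pt hn /clen addrC subrK.
    have Gt : cset (G n i) t by apply/csetP; rewrite cminE cmaxE tk ltW.
    exists (G n i, tag i); last by rewrite /ocset /= cminE cmaxE in_itv /= ti tk.
    apply/imfsetP; exists (Ordinal iltn) => //.
    by rewrite inE /=; apply: (tagP i t).
(* the lower limit of the sets A n has measure at most e and contains t as
   soon as all but finitely many of them do *)
pose B m := \bigcap_(k >= m) A k.
have mB m : measurable (B m) by apply: bigcap_measurable => [|k _]; [exists m => /=|case: (HA k)].
have mUB : measurable (\bigcup_m B m) by exact: bigcup_measurable.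
exists (\bigcup_m B m); split=> //.
  have ndB : {homo B : n m / (n <= m)%N >-> (n <= m)%O}.
    move=> n m nm; apply/subsetPset => x Bx k /= mk; apply: Bx => /=.
    exact: leq_trans mk.
  have cvB := nondecreasing_cvg_mu mB mUB ndB : nu \o B @ \oo --> _.
  rewrite -(cvg_lim _ cvB) //; apply: lime_le; first by apply/cvg_ex; eexists; exact: cvB.
  apply: nearW => m /=; have [mA le_nuA _] := HA m; apply: le_trans le_nuA.
  by apply: le_measure; rewrite ?inE //; apply: bigcap_inf => /=.
move=> t Et tI; have dt : 0 < d t.
  by apply: gd; apply/csetP; case/andP: tI => /ltW -> ->.
exists (Num.truncn (clen I / d t)) => //= k /= kt.
have [_ _ HAk] := HA k; apply: HAk => //.
rewrite /h ler_pdivrMr // mulrC -ler_pdivrMr //.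
apply/ltW/(lt_le_trans (truncnS_gt _)); by rewrite ler_nat ltnS.
Qed.

Lemma negl_var_measure0 I E nu F : nu [set cmin I] = 0 ->
  (forall J, cset J `<=` cset I -> (nu (ocset J) <= (incr F J)%:E)%E) ->
  negl_var I E (fun J _ => incr F J) -> nu.-negligible (E `&` cset I).
Proof.
move=> nu0 nuF H.
have /choice[C HC] : forall n, exists C : set (measurableTypeR R),
    [/\ measurable C, (nu C <= (n.+1%:R^-1)%:E)%E &
    forall t, E t -> cmin I < t <= cmax I -> C t].
  by move=> n; apply: negl_var_measure_le nuF H; rewrite invr_gt0.
have neg0 : nu.-negligible [set cmin I].
  by exists [set cmin I]; split=> //; exact: measurable_set1.
have mC : measurable (\bigcap_n C n) by apply: bigcapT_measurable => n; case: (HC n).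
have negC : nu.-negligible (\bigcap_n C n).
  exists (\bigcap_n C n); split=> //; apply/eqP; rewrite eq_le measure_ge0 andbT.
  apply/lee_addgt0Pr => e e0; rewrite add0e.
  have [mCn le_nuC _] := HC (Num.truncn e^-1).
  apply: (@le_trans _ _ (nu (C (Num.truncn e^-1)))).
    by apply: le_measure; rewrite ?inE //; apply: bigcap_inf.
  apply: le_trans le_nuC _; rewrite lee_fin -[leRHS]invrK lef_pV2 ?posrE ?invr_gt0 //.
  by rewrite ltW // truncnS_gt.
apply: negligibleS (negligibleU neg0 negC) => t [Et /csetP/andP[It tI]].
have [->|tI0] := eqVneq t (cmin I); first by left.
by right=> n _; have [_ _] := HC n; apply=> //; rewrite tI andbT lt_neqAle eq_sym tI0.
Qed.

Lemma negl_var_null_converse I E : negl_var I E (fun J _ => clen J) ->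
  mu.-negligible (E `&` cset I).
Proof.
move=> H; apply: (@negl_var_measure0 I E mu id) => //; first exact: lebesgue_measure_set1.
by move=> J _; rewrite le_eqVlt; apply/orP; left; apply/eqP; exact: mu_ocset.
Qed.

Lemma negl_var0 I E q : (forall J t, cset J `<=` cset I -> cset J t -> E t -> q J t = 0) ->
  negl_var I E q.
Proof.
move=> H e e0; exists (fun=> 1) => // P [tagP _] _ PI PE.
rewrite big_seq big1 ?ltW // => p pP.
by apply: H; [exact: PI|exact: tagP|exact: PE].
Qed.

(** The difference f - g is carried by a null set, where it acts as a weight. *)
Lemma primitive_null_on I f g F : null_on I (f - g) -> primitive I f F -> primitive I g F.
Proof.
move=> nfg fF; set N := [set x | cset I x /\ (f - g) x <> 0] in nfg.
have H := negl_var_weight (f - g) (fun J _ => clen_ge0 J) (negl_var_null I nfg).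
have H' : negl_var I setT (fun J t => `|(f - g) t| * clen J).
  rewrite -(setUv N); apply: negl_varU => // [J t|]; first by rewrite mulr_ge0 ?clen_ge0.
  apply: negl_var0 => J t JI /JI It /= Nt.
  have [->|fg0] := pselect ((f - g) t = 0); first by rewrite normr0 mul0r.
  by case: Nt; split.
apply: negl_var_le (negl_varD fF H') _ _ => // J t _ _ _.
rewrite -[X in _ <= _ + _ * X](ger0_norm (clen_ge0 J)) -normrM distrC (distrC (f t * _)).
have -> : incr F J - g t * clen J = (incr F J - f t * clen J) + (f - g) t * clen J.
  by rewrite !fctE; ring.
exact: ler_normD.
Qed.

(** Conversely, |f - g| |J| has small sums; with the weight 1 / |f - g| so has
    |J| for tags in the set where f and g differ, which is therefore null. *)
Lemma primitive_unique_null_on I f g F : primitive I f F -> primitive I g F ->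
  null_on I (f - g).
Proof.
move=> fF gF.
have H : negl_var I setT (fun J t => `|(f - g) t| * clen J).
  apply: negl_var_le (negl_varD fF gF) _ _ => // J t _ _ _.
  rewrite -[X in _ * X <= _](ger0_norm (clen_ge0 J)) -normrM (distrC (g t * _)).
  have -> : (f - g) t * clen J = (f t * clen J - incr F J) + (incr F J - g t * clen J).
    by rewrite !fctE; ring.
  exact: ler_normD.
have H' := negl_var_weight (fun t => ((f - g) t)^-1)
  (fun J t => mulr_ge0 (normr_ge0 ((f - g) t)) (clen_ge0 J)) H.
have /negl_var_null_converse : negl_var I [set x | (f - g) x <> 0] (fun J _ => clen J).
  apply: negl_var_le H' _ _ => // J t _ _ /= /eqP fg0.
  by rewrite mulrA -normrM mulVf // normr1 mul1r.
by apply: negligibleS => x [Ix fgx]; split.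
Qed.

End Measures.

(** * Nondecreasing primitives and absolute continuity *)

Section MonotonePrimitives.
Context {R : realType}.
Local Notation mu := (@lebesgue_measure R).
Implicit Types (I J K : cell R) (P Q : {fset cell R * R}) (f g d F W w : R -> R).
Implicit Types (E : set R) (q : cell R -> R -> R).

Lemma within_continuousP (A : set R) F : {within A, continuous F} <->
  (forall x, A x -> forall e, 0 < e -> exists2 d, 0 < d &
    forall y, A y -> `|y - x| < d -> `|F y - F x| <= e).
Proof.
rewrite continuous_subspace_in; split=> [H x Ax e e0|H x].
  have := H x; rewrite inE => /(_ Ax) /cvgrPdist_le /(_ e e0).
  rewrite near_simpl /= => Hx.
  have : nbhs_subspace (A := A) x [set t | `|F x - F t| <= e] by exact: Hx.
  rewrite -nbhs_subspace_in // => /nbhs_ballP[d /= d0 Hd].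
  exists d => // y Ay yx; rewrite distrC; apply: Hd => //.
  by rewrite /ball /= distrC.
rewrite inE => Ax; apply/cvgrPdist_le => e e0.
have [d d0 Hd] := H x Ax e e0.
have : nbhs_subspace (A := A) x [set t | `|F x - F t| <= e].
  rewrite -nbhs_subspace_in //; apply/nbhs_ballP; exists d => //= y yx Ay.
  by rewrite distrC; apply: Hd => //; rewrite distrC.
by [].
Qed.

(** For a continuous nondecreasing F this is property (N) of Lusin: the image of
    a null set is null. *)
Definition null_cont I F : Prop := forall E, mu.-negligible E ->
  negl_var I E (fun J _ => incr F J).

(** With tags in a null set the sums of |h t| |J| are small, hence so are those
    of the increments of F. *)
Lemma primitive_null_cont I h F : primitive I h F -> null_cont I F.
Proof.
move=> hF E nE.
have H := negl_var_weight h (fun J _ => clen_ge0 J) (negl_var_null I nE).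
have hF' : negl_var I E (fun J t => `|h t * clen J - incr F J|).
  by apply: negl_var_le hF _ _.
apply: negl_var_le (negl_varD hF' H) _ _ => // J t _ _ _.
rewrite -[X in _ <= _ + _ * X](ger0_norm (clen_ge0 J)) -normrM distrC.
have -> : incr F J = (incr F J - h t * clen J) + h t * clen J by rewrite subrK.
by rewrite addrK; apply: le_trans (ler_norm _) (ler_normD _ _).
Qed.

Lemma abs_continuous_null_cont I F : abs_continuous I F -> null_cont I F.
Proof.
move=> acF E nE e e0; have [d0 d00 Hac] := acF e e0.
have d2 : 0 < d0 / 2 by lra.
have [d gd Hd] := negl_var_null I nE d2.
exists d => // P famP fP PI PE.
have := Hd P famP fP PI PE; rewrite big_tnth => len; rewrite big_tnth.
set n := size P in len *; set r := tnth (in_tuple P) in len *.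
have rP i : r i \in P by exact: mem_tnth.
apply: le_trans (_ : \sum_(i < n) `|F (cmax (r i).1) - F (cmin (r i).1)| <= e).
  by apply: ler_sum => i _; exact: ler_norm.
apply/ltW/(Hac n (fun i => (r i).1)).
- by move=> i; exact: PI.
- move=> i j ij; case: famP => _; apply=> //.
  have /tuple_uniqP inj : uniq (in_tuple P) by exact: fset_uniq.
  by move=> /inj /eqP; rewrite (negPf ij).
- by apply: le_lt_trans len _; lra.
Qed.

Section Stieltjes.
Variables (I : cell R) (F : R -> R).
Hypothesis ndF : forall x y, cset I x -> cset I y -> x <= y -> F x <= F y.
Hypothesis contF : {within cset I, continuous F}.

Lemma incr_ge0 J : cset J `<=` cset I -> 0 <= incr F J.
Proof.
move=> JI; rewrite subr_ge0 ndF //; last by rewrite ltW // cmin_lt.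
  by apply: JI; exact: cset_min.
by apply: JI; exact: cset_max.
Qed.

Let clamp x := Num.max (cmin I) (Num.min x (cmax I)).

Let clampI x : cset I (clamp x).
Proof.
apply/csetP; rewrite /clamp le_max lexx /= ge_max ge_min lexx orbT andbT.
by rewrite ltW // cmin_lt.
Qed.

Let clamp_id x : cset I x -> clamp x = x.
Proof. by move=> /csetP/andP[? ?]; rewrite /clamp min_l // max_r. Qed.

Let clamp_nd x y : x <= y -> clamp x <= clamp y.
Proof.
by move=> xy; apply: le_max2 => //; exact: le_min2.
Qed.

Let clamp_lip x y : `|clamp x - clamp y| <= `|x - y|.
Proof.
wlog xy : x y / x <= y.
  by move=> W; have [/W//|/ltW/W] := leP x y; rewrite distrC (distrC x).
rewrite distrC (distrC x) (ger0_norm (_ : 0 <= y - x)) ?subr_ge0 //.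
rewrite ger0_norm ?subr_ge0 ?clamp_nd // /clamp.
have ltI := cmin_lt I.
by case: (leP x (cmax I)) => ?; case: (leP y (cmax I)) => ?;
  case: (leP (cmin I) x) => ?; case: (leP (cmin I) y) => ?;
  case: (leP (cmin I) (cmax I)) => ?; lra.
Qed.

Let Fc x := F (clamp x).

Let Fc_nd : {homo Fc : x y / x <= y}.
Proof. by move=> x y xy; apply: ndF => //; exact: clamp_nd. Qed.

Let Fc_rc : right_continuous Fc.
Proof.
apply/right_continuousW => x; apply/cvgrPdist_le => e e0.
have [d d0 Hd] := (within_continuousP _ _).1 contF _ (clampI x) e e0.
near=> y; rewrite distrC; apply: Hd => //; apply: le_lt_trans (clamp_lip _ _) _.
by rewrite distrC; near: y; exact: cvgr_dist_lt.
Unshelve. all: by end_near. Qed.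

(** The Stieltjes measure of F, restricted to I. *)
Lemma stieltjes : exists nu : {finite_measure set (measurableTypeR R) -> \bar R},
  [/\ nu (~` ocset I) = 0,
      forall J, cset J `<=` cset I -> nu (ocset J) = (incr F J)%:E
    & nu [set cmin I] = 0].
Proof.
pose c : cumulative R R := HB.pack Fc (isCumulative.Build R _ R Fc Fc_nd Fc_rc).
pose nu0 : {measure set (measurableTypeR R) -> \bar R} := lebesgue_stieltjes_measure c.
have nu0E J : nu0 (ocset J) = (incr Fc J)%:E.
  rewrite /nu0 /= /lebesgue_stieltjes_measure /measure_extension.
  rewrite measurable_mu_extE /=; last exact: is_ocitv.
  by rewrite /ocset wlength_itv_bnd // ltW // cmin_lt.
have nu0I : (nu0 (ocset I) < +oo)%E by rewrite nu0E ltry.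
exists (mfrestr (measurable_ocset I) nu0I : {finite_measure set _ -> \bar R}).
rewrite /= /mfrestr /mrestr; split.
- by rewrite setICl measure0.
- move=> J JI; rewrite (_ : ocset J `&` ocset I = ocset J).
    rewrite nu0E /incr /Fc !clamp_id //; apply: JI; [exact: cset_min|exact: cset_max].
  apply/setIidPl => x /ocsetP/andP[? ?]; move/cset_subP: JI => [? ?].
  by apply/ocsetP; apply/andP; split; lra.
- rewrite (_ : _ `&` _ = set0) ?measure0 //; apply/seteqP; split=> // x [/= ->].
  by move=> /ocsetP; rewrite ltxx.
Qed.

End Stieltjes.

Section NullContinuous.
Variables (I : cell R) (F : R -> R).
Hypothesis ndF : forall x y, cset I x -> cset I y -> x <= y -> F x <= F y.
Hypothesis contF : {within cset I, continuous F}.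
Hypothesis ncF : null_cont I F.

(** A null set has negligible variation by property (N), hence Stieltjes
    measure 0. *)
Lemma stieltjes_dominated : exists nu : {finite_measure set (measurableTypeR R) -> \bar R},
  null_dominates mu nu /\
  forall J, cset J `<=` cset I -> nu (ocset J) = (incr F J)%:E.
Proof.
have [nu [nuC nuJ nu0]] := stieltjes ndF contF.
exists nu; split; last exact: nuJ.
apply/null_content_dominatesP => A mA A0.
have negA : mu.-negligible A by exists A; split.
have nuF J : cset J `<=` cset I -> (nu (ocset J) <= (incr F J)%:E)%E.
  by move=> JI; rewrite le_eqVlt; apply/orP; left; apply/eqP; exact: nuJ.
have H := negl_var_measure0 nu0 nuF (ncF negA).
have negC : nu.-negligible (~` ocset I).
  by exists (~` ocset I); split=> //; apply: measurableC; exact: measurable_ocset.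
apply: measure_negligible => //; apply: negligibleS (negligibleU H negC) => x Ax.
by have [Ix|nIx] := pselect (ocset I x); [left; split=> //; exact: ocset_cset|right].
Qed.

(** The measure-theoretic form of absolute continuity of the Stieltjes measure,
    applied to finite unions of half-open cells. *)
Lemma null_cont_abs_continuous : abs_continuous I F.
Proof.
move=> e e0; have [nu [numu nuJ]] := stieltjes_dominated.
have [P [N nuPN]] := Hahn_decomposition (charge_of_finite_measure nu).
have [d [d0 Hd]] := charge_variation_continuous nuPN numu e0.
exists d => // n J JI nonJ len.
have tJ : trivIset [set: 'I_n] (fun i => ocset (J i)).
  apply/trivIsetP => i j _ _ ij; have /nonoverlappingP := nonJ i j ij.
  move: ij => _ ij; apply/seteqP; split=> // x [/ocsetP/andP[? ?] /ocsetP/andP[? ?]] /=.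
  by case: ij => ?; lra.
have mJ i : measurable (ocset (J i)) by exact: measurable_ocset.
have sumJ (m : {measure set (measurableTypeR R) -> \bar R}) :
    m (\big[setU/set0]_(i < n) ocset (J i)) = (\sum_(i < n) m (ocset (J i)))%E.
  exact: measure_bigsetU_ord.
have mA : measurable (\big[setU/set0]_(i < n) ocset (J i)) by exact: bigsetU_measurable.
move: (\big[setU/set0]_(i < n) ocset (J i)) mA sumJ => A mA sumA.
have muA : (mu A < d%:E)%E.
  have -> : mu A = (\sum_(i < n) clen (J i))%:E.
    rewrite -sumEFin; apply: etrans (sumA mu) _.
    by apply: eq_bigr => i _; exact: mu_ocset.
  by rewrite lte_fin.
have nuA : nu A = (\sum_(i < n) `|F (cmax (J i)) - F (cmin (J i))|)%:E.
  rewrite -sumEFin; apply: etrans (sumA nu) _; apply: eq_bigr => i _.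
  apply: etrans (nuJ _ (JI i)) _.
  by rewrite -/(incr F (J i)) ger0_norm // (incr_ge0 ndF (JI i)).
rewrite -lte_fin -nuA; apply: le_lt_trans (Hd _ mA muA).
exact: le_trans (lee_abs _) (abse_charge_variation nuPN mA).
Qed.

(** F differs by a constant from the integral of the density of its Stieltjes
    measure, which is differentiable almost everywhere. *)
Lemma null_cont_derivable :
  mu.-negligible [set x | cmin I < x < cmax I /\ ~ derivable F x (1 : R)].
Proof.
have [nu [numu nuJ]] := stieltjes_dominated.
have numu' : null_dominates mu (charge_of_finite_measure nu) by exact: numu.
pose h := Radon_Nikodym (charge_of_finite_measure nu) mu.
have hfin x : h x \is a fin_num by exact: Radon_Nikodym_fin_num.
pose g := fine \o h.
have gE : EFin \o g = h by apply/funext => x; rewrite /= fineK.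
have intg : mu.-integrable [set: R] (EFin \o g).
  by rewrite gE; exact: Radon_Nikodym_integrable.
have locg : locally_integrable [set: R] g.
  by apply: open_integrable_locally => //; exact: openT.
have := @FTC1 R g (BRight (cmin I)) _ locg => /(_ _) [y|B [mB B0 HB]].
  exact: integrableS intg.
exists B; split=> // x /= [/andP[ax xb] ndx]; apply: HB => /= HB; apply: ndx.
have [dG _] := HB ax.
pose G y : R := (\int[mu]_(t in [set` Interval (BRight (cmin I)) (BRight y)]) g t)%R.
have dGF : derivable (G + cst (F (cmin I))) x (1 : R).
  by apply: derivableD => //; exact: derivable_cst.
apply: near_eq_derivable dGF; near=> y.
have ay : cmin I < y by near: y; exact: lt_nbhsr.
have yb : y < cmax I by near: y; exact: lt_nbhsl.
have ay' : (cmin I, y).1 < (cmin I, y).2 by [].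
pose J := Cell ay'.
have JI : cset J `<=` cset I by apply/cset_subP; rewrite cminE cmaxE lexx ltW.
have nuE : nu (ocset J) = (\int[mu]_(t in ocset J) h t)%E.
  apply: (@Radon_Nikodym_integral _ _ _ (charge_of_finite_measure nu) mu) => //.
  exact: measurable_ocset.
have : (G y)%:E = (incr F J)%:E.
  rewrite -nuJ // nuE /G /Rintegral fineK; first by rewrite -gE.
  by apply: integrable_fin_num => //; apply: integrableS intg.
by move=> [GE]; rewrite !fctE GE /incr cminE cmaxE subrK.
Unshelve. all: by end_near. Qed.

(** By the Radon-Nikodym theorem and Lebesgue's differentiation theorem, F is
    differentiable outside a null set. The straddle lemma handles the points
    of differentiability, property (N) the remaining ones. *)
Lemma null_cont_primitive : primitive I (derivative0 F) F.
Proof.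
(* at the two ends of I differentiability depends on F outside I, so the ends
   are treated as exceptional points *)
pose N := [set x | cmin I < x < cmax I /\ ~ derivable F x (1 : R)]
  `|` ([set cmin I] `|` [set cmax I]).
have neg1 x : mu.-negligible [set x].
  by exists [set x]; split=> //; exact: lebesgue_measure_set1.
have negN : mu.-negligible N.
  by apply: negligibleU; [exact: null_cont_derivable|exact: negligibleU].
have HN : negl_var I N (fun J t => `|derivative0 F t * clen J - incr F J|).
  have H := negl_var_weight (derivative0 F) (fun J _ => clen_ge0 J) (negl_var_null I negN).
  apply: negl_var_le (negl_varD H (ncF negN)) _ _ => // J t JI _ _.
  apply: le_trans (ler_normB _ _) _; rewrite normrM (ger0_norm (clen_ge0 J)).
  by rewrite (ger0_norm (incr_ge0 ndF JI)).
have H := negl_varU (fun J t => normr_ge0 (derivative0 F t * clen J - incr F J))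
  (@negl_var_derive _ I F (derivative0 F)) HN.
suff H' : negl_var I (cset I) (fun J t => `|derivative0 F t * clen J - incr F J|).
  by move=> e /H'[d gd Hd]; exists d => // P famP fP PI _; apply: Hd => // p pP;
     apply: (PI p pP); case: famP => + _; exact.
apply: negl_var_le H _ _ => // t It.
have [dt|ndt] := pselect (derivable F t (1 : R)).
  left; rewrite /= /derivative0 asboolT // derive1E.
  exact: derivableP.
right; have /csetP/andP[] := It.
rewrite le_eqVlt => /predU1P[<- _|at']; first by right; left.
rewrite le_eqVlt => /predU1P[-> |tb]; first by right; right.
by left; rewrite /= at' tb.
Qed.

End NullContinuous.
End MonotonePrimitives.

(** * Change of variables *)

Section ChangeOfVariables.
Context {R : realType}.
Implicit Types (I J K : cell R) (P Q : {fset cell R * R}) (f g h d F phi : R -> R).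

(** The cell from phi (min J) to phi (max J); the condition holds for J in I. *)
Let image_cell phi J : cell R :=
  if pselect ((phi (cmin J), phi (cmax J)).1 < (phi (cmin J), phi (cmax J)).2) is left lt
  then Cell lt else J.

(** An increasing homeomorphism carries fine families to fine families. *)
Lemma negl_var_comp I K phi f F : set_fun (cset I) (cset K) phi ->
  {within cset I, continuous phi} ->
  {in cset I &, {homo phi : x y / x < y}} -> primitive K f F ->
  negl_var I setT (fun J t => `|f (phi t) * incr phi J - incr (F \o phi) J|).
Proof.
move=> phiK cphi phi_lt fF e e0; have [d gd Hd] := fF e e0.
have ltP x y : cset I x -> cset I y -> x < y -> phi x < phi y.
  by move=> Ix Iy; apply: phi_lt; rewrite inE.
have leP x y : cset I x -> cset I y -> x <= y -> phi x <= phi y.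
  by move=> Ix Iy; rewrite le_eqVlt => /predU1P[->//|/(ltP _ _ Ix Iy)/ltW].
have /choice[d' Hd'] : forall t, exists r, cset I t -> 0 < r /\
    forall y, cset I y -> `|y - t| <= r -> `|phi y - phi t| <= d (phi t).
  move=> t; have [It|] := pselect (cset I t); last by exists 0.
  have dt : 0 < d (phi t) by apply: gd; exact: phiK.
  have [r r0 Hr] := (within_continuousP _ _).1 cphi t It _ dt.
  exists (r / 2) => _; split; first by lra.
  by move=> y Iy yt; apply: Hr => //; lra.
exists d' => [t /Hd'[]//|P famP fP PI _].
have endI p : p \in P -> cset I (cmin p.1) /\ cset I (cmax p.1).
  by move=> pP; split; apply: (PI _ pP); [exact: cset_min|exact: cset_max].
have minE p : p \in P -> cmin (image_cell phi p.1) = phi (cmin p.1).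
  move=> pP; rewrite /image_cell; case: pselect => // -[].
  by have [? ?] := endI p pP; apply: ltP => //; exact: cmin_lt.
have maxE p : p \in P -> cmax (image_cell phi p.1) = phi (cmax p.1).
  move=> pP; rewrite /image_cell; case: pselect => // -[].
  by have [? ?] := endI p pP; apply: ltP => //; exact: cmin_lt.
pose m p := (image_cell phi p.1, phi p.2).
have nonm p q : p \in P -> q \in P -> p <> q ->
    nonoverlapping (image_cell phi p.1) (image_cell phi q.1).
  move=> pP qP pq; apply/nonoverlappingP; rewrite !minE ?maxE //.
  have [? ?] := endI p pP; have [? ?] := endI q qP.
  case: famP => _ /(_ _ _ pP qP pq) /nonoverlappingP[?|?]; [left|right]; exact: leP.
have injm : {in P &, injective m}.
  move=> p q pP qP [E _]; apply: contrapT => /(nonm _ _ pP qP).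
  by rewrite E => /nonoverlappingP[]; rewrite leNgt cmin_lt.
pose P' := [fset m p | p in P]%fset.
have P'P p : p \in P' -> exists2 p0, p0 \in P & p = m p0.
  by case/imfsetP => p0 /= p0P ->; exists p0.
have := Hd P'; rewrite big_imfset //= => HP'.
apply: le_trans (HP' _ _ _ _).
- rewrite big_seq [leRHS]big_seq; apply: ler_sum => p pP.
  by rewrite /incr /clen minE // maxE.
- split=> [_ /P'P[p pP ->] /=|_ _ /P'P[p pP ->] /P'P[q qP ->] pq].
    apply/csetP; rewrite minE // maxE //; have [? ?] := endI p pP.
    have tp : cset p.1 p.2 by case: famP => + _; exact.
    have Ip := PI p pP _ tp; move/csetP: tp => /andP[? ?].
    by apply/andP; split; exact: leP.
  by apply: nonm => // E; rewrite E in pq.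
- move=> _ /P'P[p pP ->] y /csetP /=; rewrite minE // maxE // in_itv /=.
  have [Imin Imax] := endI p pP.
  have It : cset I p.2 by apply: (PI p pP); case: famP => + _; exact.
  have [_ Hp] := Hd' _ It.
  have near x : cset p.1 x -> `|x - p.2| <= d' p.2.
    move=> /(fP _ pP) /=; rewrite in_itv /= => /andP[h1 h2].
    by rewrite ler_norml; apply/andP; split; lra.
  have := Hp _ Imin (near _ (cset_min _)); have := Hp _ Imax (near _ (cset_max _)).
  rewrite !ler_norml => /andP[? ?] /andP[? ?] /andP[? ?].
  by apply/andP; split; lra.
- move=> _ /P'P[p pP ->]; have [Imin Imax] := endI p pP.
  apply/cset_subP; rewrite /= minE // maxE //.
  by have /csetP/andP[] := phiK _ Imin; have /csetP/andP[] := phiK _ Imax.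
- by [].
Qed.

(** Change of variables: the error is split between the error of phi,
    weighted by f o phi, and the error of F along the image family. *)
Lemma primitive_comp I K phi h f F : set_fun (cset I) (cset K) phi ->
  {within cset I, continuous phi} ->
  {in cset I &, {homo phi : x y / x < y}} -> primitive I h phi -> primitive K f F ->
  primitive I (fun x => f (phi x) * h x) (F \o phi).
Proof.
move=> phiK cphi phi_lt hphi fF.
have H1 := negl_var_weight (f \o phi)
  (fun J t => normr_ge0 (h t * clen J - incr phi J)) hphi.
have H2 := negl_var_comp phiK cphi phi_lt fF.
apply: negl_var_le (negl_varD H1 H2) _ _ => // J t _ _ _; rewrite -normrM.
have -> : f (phi t) * h t * clen J - incr (F \o phi) J =
  (f \o phi) t * (h t * clen J - incr phi J) + (f (phi t) * incr phi J - incr (F \o phi) J).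
  by rewrite /=; ring.
exact: ler_normD.
Qed.

End ChangeOfVariables.

(** * Equivalence classes and their primitives *)

Section Classes.
Context {R : realType}.
Variable I : cell R.
Implicit Types (f g Phi : R -> R) (F G H : KHspace I).
Local Open Scope quotient_scope.

Lemma in_class_repr F : in_class F (KHval (repr F)).
Proof.
case E : (repr F) => [f fKH] /=; exists fKH.
by rewrite -E (@reprK _ (KHspace I)).
Qed.

Lemma pi_eqP (u v : KHfun I) :
  \pi_(KHspace I) u = \pi_(KHspace I) v <-> null_on I (KHval u - KHval v).
Proof.
split=> [/eqP|nuv].
  by rewrite -Quotient.idealrBE => /asboolP.
by apply/eqP; rewrite -Quotient.idealrBE; apply/asboolP.
Qed.

Lemma in_class_null F f g : in_class F f -> in_class F g -> null_on I (f - g).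
Proof. by move=> [fKH ->] [gKH] /pi_eqP. Qed.

Lemma in_class_eq F G f : in_class F f -> in_class G f -> F = G.
Proof.
move=> [fKH ->] [fKH' ->]; apply/pi_eqP => /=.
by rewrite subrr; apply: negligibleS (negligible_set0 _) => x [].
Qed.

Lemma null_in_class F f g : in_class F f -> g \in KH I -> null_on I (f - g) -> in_class F g.
Proof. by move=> [fKH ->] gKH nfg; exists gKH; apply/pi_eqP. Qed.

Lemma in_classD F G f g : in_class F f -> in_class G g -> in_class (F + G) (f + g).
Proof.
move=> [fKH ->] [gKH ->]; have fgKH : f + g \in KH I by exact: rpredD.
exists fgKH; rewrite -[LHS]Quotient.pi_add; congr (\pi_ _ _).
exact: val_inj.
Qed.

Lemma in_classZ F f (a : R) : in_class F f -> in_class (a *: F) (a *: f).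
Proof.
move=> [fKH ->]; have afKH : a *: f \in KH I by exact: rpredZ.
exists afKH; rewrite [LHS]KHscale_pi; congr (\pi_ _ _).
exact: val_inj.
Qed.

(** Members of a class differ on a null set, hence share their primitives. *)
Lemma class_primitive F : exists Phi, Phi (cmin I) = 0 /\
  forall f, in_class F f -> primitive I f Phi.
Proof.
have Fr := in_class_repr F.
have [Phi0 Phi0P] := KH_primitive (proj1_sig (cid Fr)).
pose Phi x := Phi0 x - Phi0 (cmin I).
exists Phi; split; first by rewrite /Phi subrr.
move=> f Ff; apply: primitive_null_on (in_class_null Fr Ff) _.
apply: negl_var_le Phi0P _ _ => // J t _ _ _.
by have -> : incr Phi J = incr Phi0 J by rewrite /incr /Phi; ring.
Qed.

(** The primitive vanishing at min I shared by all members of a class; the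
    Alexiewicz norm is its supremum norm. *)
Definition prim F : R -> R := proj1_sig (cid (class_primitive F)).

Lemma prim_min F : prim F (cmin I) = 0.
Proof. by rewrite /prim; case: cid => Phi []. Qed.

Lemma prim_primitive F f : in_class F f -> primitive I f (prim F).
Proof. by move=> Ff; have [_] := proj2_sig (cid (class_primitive F)); apply. Qed.

Lemma prim_unique F f Phi x : in_class F f -> primitive I f Phi -> Phi (cmin I) = 0 ->
  cset I x -> prim F x = Phi x.
Proof.
move=> Ff fPhi Phi0 Ix; have [->|xI] := eqVneq x (cmin I); first by rewrite prim_min.
move/csetP: Ix => /andP[ax xb].
have ax' : (cmin I, x).1 < (cmin I, x).2 by rewrite /= lt_neqAle eq_sym xI.
have JI : cset (Cell ax') `<=` cset I by apply/cset_subP.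
have := primitive_incr_unique (prim_primitive Ff) fPhi JI.
by rewrite /incr cminE cmaxE prim_min Phi0 !subr0.
Qed.

Lemma primD F G x : cset I x -> prim (F + G) x = prim F x + prim G x.
Proof.
move=> Ix; have Fr := in_class_repr F; have Gr := in_class_repr G.
rewrite (prim_unique (in_classD Fr Gr) (primitiveD (prim_primitive Fr) (prim_primitive Gr))) //.
by rewrite !fctE !prim_min addr0.
Qed.

Lemma primZ F (a : R) x : cset I x -> prim (a *: F) x = a * prim F x.
Proof.
move=> Ix; have Fr := in_class_repr F.
rewrite (prim_unique (in_classZ a Fr) (primitiveZ a (prim_primitive Fr))) //.
by rewrite !fctE !prim_min scaler0.
Qed.

Lemma prim_surj f Phi : primitive I f Phi -> Phi (cmin I) = 0 ->
  exists2 F, in_class F f & forall x, cset I x -> prim F x = Phi x.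
Proof.
move=> fPhi Phi0; have fKH := primitive_KH fPhi.
exists (\pi_(KHspace I) (KHFun fKH)); first by exists fKH.
by move=> x Ix; apply: prim_unique fPhi Phi0 Ix; exists fKH.
Qed.

Lemma prim_in_class F f : primitive I f (prim F) -> in_class F f.
Proof.
move=> fF; have Fr := in_class_repr F.
have nf := primitive_unique_null_on (prim_primitive Fr) fF.
exact: null_in_class Fr (primitive_KH fF) nf.
Qed.

Lemma prim_inj F G : (forall x, cset I x -> prim F x = prim G x) -> F = G.
Proof.
move=> FG; have Fr := in_class_repr F.
have FPG := primitive_congr FG (prim_primitive Fr).
exact: in_class_eq Fr (prim_in_class FPG).
Qed.

Lemma prim_continuous F : {within cset I, continuous (prim F)}.
Proof.
apply/within_continuousP => x Ix.
exact: primitive_cvg (prim_primitive (in_class_repr F)) Ix.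
Qed.

(** The maximum of the continuous function |prim F| is reached. If it is reached
    at min I it is 0, and then max I is a maximum point as well: the norm only
    takes nondegenerate cells into account. *)
Lemma normA_attained F : (forall x, cset I x -> `|prim F x| <= normA F) /\
  exists2 x, cset I x & `|prim F x| = normA F.
Proof.
have ltI := cmin_lt I.
have cont : {within `[cmin I, cmax I], continuous (fun x => `|prim F x|)}.
  apply/(within_continuousP (cset I)) => x Ix e e0.
  have [d d0 Hd] := (within_continuousP _ _).1 (@prim_continuous F) x Ix e e0.
  exists d => // y Iy yx; apply: le_trans (ler_dist_dist _ _) _; exact: Hd.
have [c cI maxc] := EVT_max (ltW ltI) cont.
have {cI maxc c} [c Ic [ac maxc]] : exists2 c, cset I c & cmin I < c /\
    forall x, cset I x -> `|prim F x| <= `|prim F c|.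
  have [cE|ca] := eqVneq c (cmin I); last first.
    exists c => //; split=> //; move: cI; rewrite in_itv /= => /andP[? _].
    by rewrite lt_neqAle eq_sym ca.
  exists (cmax I); [exact: cset_max|split=> // x Ix].
  by apply: le_trans (maxc x Ix) _; rewrite cE prim_min normr0.
suff E : normA F = `|prim F c|.
  by rewrite E; split=> //; exists c.
have KHintE J : cmin J = cmin I -> cmax J <= cmax I ->
    KHint J (KHval (repr F)) = prim F (cmax J).
  move=> minJ maxJ; rewrite (primitive_KHint (prim_primitive (in_class_repr F))).
    by rewrite /incr minJ prim_min subr0.
  by apply/cset_subP; rewrite minJ lexx.
have ac' : (cmin I, c).1 < (cmin I, c).2 by [].
have cb : c <= cmax I by move/csetP: Ic => /andP[].
apply/eqP; rewrite eq_le /normA; apply/andP; split.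
  apply: ge_sup; first by exists `|KHint I (KHval (repr F))|, I.
  move=> _ [J [minJ maxJ] <-]; rewrite KHintE //; apply: maxc.
  by apply/csetP; rewrite maxJ -minJ ltW // cmin_lt.
apply: sup_upper_bound.
  split; first by exists `|KHint I (KHval (repr F))|, I.
  exists `|prim F c| => _ [J [minJ maxJ] <-]; rewrite KHintE //; apply: maxc.
  by apply/csetP; rewrite maxJ -minJ ltW // cmin_lt.
by exists (Cell ac'); rewrite ?KHintE.
Qed.

Lemma normA_ge F x : cset I x -> `|prim F x| <= normA F.
Proof. by have [+ _] := normA_attained F; apply. Qed.

End Classes.

(** * Isometries are weighted composition operators *)

Section Isometries.
Context {R : realType}.

(** The rational function 2 s c / (s ^ 2 + c ^ 2) of s = y - min K with
    c = x0 - min K: on K its values lie between 0 and 1, and by the inequality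
    of means the value 1 is reached at x0 only. *)
Lemma peak (K : cell R) (x0 : R) : cmin K < x0 <= cmax K ->
  exists2 U : KHspace K, prim U x0 = 1 &
    (forall y, cset K y -> 0 <= prim U y <= 1) /\
    forall d, 0 < d -> exists2 q, q < 1 &
      forall y, cset K y -> d <= `|y - x0| -> prim U y <= q.
Proof.
move=> /andP[ax0 x0b]; set a := cmin K; pose c := x0 - a.
have c0 : 0 < c by rewrite subr_gt0.
have den0 s : 0 < s ^+ 2 + c ^+ 2 by rewrite ltr_wpDl ?sqr_ge0 // exprn_gt0.
pose p (y : R) : R := 2 * (y - a) * c / ((y - a) ^+ 2 + c ^+ 2).
have dp (t : R) : derivable p t (1 : R).
  apply: derivableM; first by apply: derivableM => //; apply: derivableM => //; apply: derivableB.
  apply: derivableV; first by rewrite gt_eqF.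
  by apply: derivableD => //; apply: derivableX; apply: derivableB.
have pp : primitive K (derive1 p) p.
  by apply: primitive_derive => t; rewrite derive1E; apply: derivableP.
have p0 : p a = 0 by rewrite /p subrr mulr0 !mul0r.
have px0 : p x0 = 1.
  rewrite /p -/c; have := den0 c; rewrite -mulr2n => cc.
  by rewrite (_ : 2 * c * c = c ^+ 2 *+ 2) ?divff ?gt_eqF // mulr2n; ring.
have [U _ UE] := prim_surj pp p0.
have Kx0 : cset K x0 by apply/csetP; rewrite ltW.
pose L := clen K; have L0 : 0 < L by rewrite subr_gt0 cmin_lt.
exists U; first by rewrite UE.
split=> [y Ky|d d0].
  rewrite UE // /p; move/csetP: Ky => /andP[ay yb].
  have ya : 0 <= y - a by rewrite subr_ge0.
  apply/andP; split.
    apply: divr_ge0; last exact: ltW.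
    by apply: mulr_ge0; [exact: mulr_ge0|exact: ltW].
  by rewrite ler_pdivrMr // mul1r; have := sqr_ge0 (y - a - c); lra.
(* the function is 1 - (y - x0) ^ 2 / (s ^ 2 + c ^ 2) with s, c <= L *)
exists (1 - d ^+ 2 / (L ^+ 2 *+ 2)).
  by rewrite gtrBl divr_gt0 ?exprn_gt0 // mulrn_wgt0 // exprn_gt0.
move=> y Ky dy; rewrite UE // /p; move/csetP: Ky => /andP[ay yb].
have ya : 0 <= y - a by rewrite subr_ge0.
have yL : (y - a) ^+ 2 <= L ^+ 2 by rewrite ler_pXn2r ?nnegrE ?(ltW L0) // lerB.
have cL : c ^+ 2 <= L ^+ 2 by rewrite ler_pXn2r ?nnegrE ?(ltW L0) ?(ltW c0) // lerB.
have dd : d ^+ 2 <= (y - x0) ^+ 2.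
  by rewrite -(real_normK (num_real (y - x0))) ler_pXn2r ?nnegrE ?(ltW d0).
have E : 2 * (y - a) * c / ((y - a) ^+ 2 + c ^+ 2) =
    1 - (y - x0) ^+ 2 / ((y - a) ^+ 2 + c ^+ 2).
  have := den0 (y - a); rewrite lt0r => /andP[nz _].
  by apply: (mulIf nz); rewrite divfK // mulrBl mul1r divfK // /c; ring.
rewrite E lerD2l lerN2; apply: ler_pM.
- exact: sqr_ge0.
- by rewrite invr_ge0 mulrn_wge0 // sqr_ge0.
- exact: dd.
- rewrite lef_pV2 ?posrE ?den0 //; first by rewrite mulr2n lerD.
  by rewrite mulrn_wgt0 // exprn_gt0.
Qed.

Lemma linear_isometry_norm (K I : cell R) (T : KHspace K -> KHspace I) :
  (forall a F G, T (a *: F + G) = a *: T F + T G) ->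
  (forall F G, normA (T F - T G) = normA (F - G)) ->
  forall F, normA (T F) = normA F.
Proof.
move=> linT isoT F; have T0 : T 0 = 0.
  by have := linT (-1) 0 0; rewrite scaler0 addr0 scaleN1r addNr.
by have := isoT F 0; rewrite T0 !subr0.
Qed.

(** The heart of the Banach-Stone argument. Let prim U peak at x0 and let
    prim (T U) take its extreme value tau, of absolute value 1, at x. For large
    lam the norm of lam U + F is at most lam + prim F x0 + e, and it bounds
    lam + tau * prim (T F) x from above. Hence tau * prim (T F) x <= prim F x0,
    for F and for - F. *)
Lemma isometry_point (K I : cell R) (T : KHspace K -> KHspace I) :
  (forall a F G, T (a *: F + G) = a *: T F + T G) ->
  (forall F, normA (T F) = normA F) ->
  forall x0, cmin K < x0 <= cmax K ->
  exists x tau, [/\ cset I x, tau = -1 \/ tau = 1 &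
    forall F, prim F x0 = tau * prim (T F) x].
Proof.
move=> linT isoT x0 x0K; have [U Ux0 [U01 Uq]] := peak x0K.
have Kx0 : cset K x0 by case/andP: x0K => ? ?; apply/csetP; rewrite ltW.
have nU : normA U = 1.
  apply/eqP; rewrite eq_le; apply/andP; split; last first.
    by have := normA_ge U Kx0; rewrite Ux0 normr1.
  have [_ [y Ky <-]] := normA_attained U.
  by have /andP[? ?] := U01 y Ky; rewrite ger0_norm.
have [_ [x Ix nTUx]] := normA_attained (T U).
rewrite isoT nU in nTUx; pose tau := prim (T U) x.
have tau1 : tau = -1 \/ tau = 1.
  move/eqP: nTUx; rewrite -/tau eqr_norml ler01 andbT => /orP[/eqP|/eqP]; by [right|left].
have tautau : tau * tau = 1 by case: tau1 => ->; ring.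
have ntau : `|tau| = 1 by case: tau1 => ->; rewrite ?normrN normr1.
have T0 : T 0 = 0.
  by have := linT (-1) 0 0; rewrite scaler0 addr0 scaleN1r addNr.
have TN F : T (- F) = - T F.
  by have := linT (-1) F 0; rewrite !scaleN1r T0 !addr0.
have key F : tau * prim (T F) x <= prim F x0.
  apply/ler_addgt0Pr => e e0.
  have [d d0 Hd] := (within_continuousP _ _).1 (@prim_continuous _ _ F) x0 Kx0 e e0.
  have [q q1 Hq] := Uq d d0.
  set N := normA F; have N0 : 0 <= N by apply: le_trans (normA_ge F Kx0).
  (* lam is so large that lam * q + N <= lam - N, which bounds F + lam U away
     from x0, where U is at most q *)
  pose lam := N *+ 2 / (1 - q) + N *+ 2.
  have lam2 : N *+ 2 <= lam.
    by rewrite lerDr divr_ge0 ?mulrn_wge0 // subr_ge0 ltW.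
  have lamq : N *+ 2 <= lam * (1 - q).
    rewrite mulrDl divfK ?subr_eq0 ?gt_eqF // lerDl mulr_ge0 ?mulrn_wge0 //.
    by rewrite subr_ge0 ltW.
  have lam0 : 0 <= lam by apply: le_trans lam2; rewrite mulrn_wge0.
  have Fbound y : cset K y -> - N <= prim F y <= N.
    by move=> Ky; have := normA_ge F Ky; rewrite ler_norml.
  have nFU : normA (lam *: U + F) <= lam + prim F x0 + e.
    have [_ [y Ky <-]] := normA_attained (lam *: U + F).
    rewrite primD // primZ //.
    have /andP[Fy1 Fy2] := Fbound y Ky; have /andP[Fx1 Fx2] := Fbound x0 Kx0.
    have /andP[Uy0 Uy1] := U01 y Ky.
    rewrite mulr2n in lam2 lamq.
    rewrite ler_norml; apply/andP; split; first by have := mulr_ge0 lam0 Uy0; lra.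
    have [near|far] := ltP `|y - x0| d.
      by have := Hd y Ky near; rewrite ler_norml => /andP[_ ?]; have := ler_wpM2l lam0 Uy1; lra.
    by have := ler_wpM2l lam0 (Hq y Ky far); lra.
  have := normA_ge (T (lam *: U + F)) Ix; rewrite isoT linT primD // primZ // -/tau.
  have : tau * (lam * tau + prim (T F) x) <= `|lam * tau + prim (T F) x|.
    by apply: le_trans (ler_norm _) _; rewrite normrM ntau mul1r.
  have -> : tau * (lam * tau + prim (T F) x) = lam * (tau * tau) + tau * prim (T F) x by ring.
  by rewrite tautau; lra.
exists x, tau; split=> // F; apply/eqP; rewrite eq_le key andbT.
have := key (- F); rewrite TN -[- F]scaleN1r -[- T F]scaleN1r !primZ //.
by rewrite mulN1r mulN1r mulrN lerN2.
Qed.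

(** Applied to the inverse S of T, the previous lemma represents T by points of K
    and signs. With U the class of the constant 1, prim (T U) x is the sign at x
    times the distance of the point from min K. That distance vanishes only at
    min I, because T is onto; so the sign is constant by the intermediate value
    theorem, and the point is min K + sigma * prim (T U) x. *)
Lemma isometry_representation (K I : cell R)
    (T : KHspace K -> KHspace I) (S : KHspace I -> KHspace K) :
  (forall a F G, S (a *: F + G) = a *: S F + S G) ->
  (forall H, normA (S H) = normA H) -> cancel T S -> cancel S T ->
  exists sigma phi h, [/\ sigma = -1 \/ sigma = 1, set_fun (cset I) (cset K) phi,
    phi (cmin I) = cmin K, primitive I h phi &
    forall F x, cset I x -> prim (T F) x = sigma * prim F (phi x)].
Proof.
move=> linS isoS TS ST.
have [U _ UE] := prim_surj (primitive_id K) (subrr _).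
have [V _ VE] := prim_surj (primitive_id I) (subrr _).
have /choice[pt Hpt] : forall x, exists ytau : R * R, cmin I < x <= cmax I ->
    [/\ cset K ytau.1, ytau.2 = -1 \/ ytau.2 = 1 &
    forall F, prim (T F) x = ytau.2 * prim F ytau.1].
  move=> x; have [xI|] := pselect (cmin I < x <= cmax I); last by exists (0, 0).
  have [y [tau [Ky tau1 H]]] := isometry_point linS isoS xI.
  by exists (y, tau) => _; split=> // F; rewrite H TS.
have ocI x : cset I x -> x = cmin I \/ cmin I < x <= cmax I.
  move=> /csetP/andP[]; rewrite le_eqVlt => /predU1P[->|-> ->]; by [left|right].
set G := prim (T U).
have GE x : cmin I < x <= cmax I -> G x = (pt x).2 * ((pt x).1 - cmin K).
  by move=> xI; have [Ky _ H] := Hpt x xI; rewrite /G H UE.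
have pos x : cmin I < x <= cmax I -> 0 < (pt x).1 - cmin K.
  move=> xI; have [/csetP/andP[Ky _] _ H] := Hpt x xI.
  rewrite subr_gt0 lt_neqAle Ky andbT; apply/eqP => E.
  have := H (S V); rewrite ST VE; last by case/andP: xI => ? ?; apply/csetP; rewrite ltW.
  by rewrite -E prim_min mulr0 => /eqP; rewrite subr_eq0 gt_eqF //; case/andP: xI.
have bI : cmin I < cmax I <= cmax I by rewrite cmin_lt lexx.
pose sigma := (pt (cmax I)).2.
have sigma1 : sigma = -1 \/ sigma = 1 by case: (Hpt _ bI).
have sign x : cmin I < x <= cmax I -> (pt x).2 = sigma.
  move=> xI; have [_ tau1 _] := Hpt x xI; apply: contrapT => ns.
  have xb : x <= cmax I by case/andP: xI.
  have cG : {within `[x, cmax I], continuous G}.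
    apply: continuous_subspaceW (@prim_continuous _ _ (T U)) => y /=.
    rewrite in_itv /= => /andP[xy yb]; apply/csetP; rewrite yb andbT.
    by apply: le_trans xy; case/andP: xI => /ltW.
  have [] := @IVT _ G x (cmax I) 0 xb cG.
    have := pos x xI; have := pos _ bI; rewrite GE // GE //.
    rewrite -/sigma ge_min le_max; case: sigma1 ns => -> ns; case: tau1 ns => -> ns // ? ?.
      by apply/andP; split; apply/orP; [right|left]; lra.
    by apply/andP; split; apply/orP; [left|right]; lra.
  move=> z; rewrite in_itv /= => /andP[xz zb] Gz.
  have zI : cmin I < z <= cmax I by rewrite zb andbT; case/andP: xI => /lt_le_trans ->.
  have := pos z zI; have [_ tauz _] := Hpt z zI.
  by have := GE z zI; rewrite Gz; case: tauz => ->; lra.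
have sigma2 : sigma * sigma = 1 by case: sigma1 => ->; ring.
pose phi x := cmin K + sigma * G x.
have phiE x : cmin I < x <= cmax I -> phi x = (pt x).1.
  by move=> xI; rewrite /phi GE // sign // mulrA sigma2; ring.
have phi0 : phi (cmin I) = cmin K by rewrite /phi /G prim_min mulr0 addr0.
exists sigma, phi, (sigma *: KHval (repr (T U))); split=> //.
- move=> x /ocI[->|xI]; first by rewrite phi0; exact: cset_min.
  by rewrite phiE //; case: (Hpt x xI).
- have GP := primitiveZ sigma (prim_primitive (in_class_repr (T U))).
  apply: negl_var_le GP _ _ => // J t _ _ _.
  rewrite (_ : incr phi J = incr (sigma *: prim (T U)) J) // /incr /phi /G !scalrfctE.
  by rewrite /GRing.scale /=; ring.
- move=> F x /ocI[->|xI]; first by rewrite phi0 !prim_min mulr0.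
  by rewrite phiE //; have [_ _ ->] := Hpt x xI; rewrite sign.
Qed.

End Isometries.

(** * The equivalence *)

Section Main.
Context {R : realType}.

Lemma normA_eq0 (I : cell R) (F : KHspace I) : normA F = 0 -> F = 0.
Proof.
move=> F0; apply: prim_inj => x Ix.
have -> : prim (0 : KHspace I) x = 0 by rewrite -(scale0r F) primZ // mul0r.
by apply/eqP; rewrite -normr_le0 -F0; exact: normA_ge.
Qed.

Lemma normA0 (I : cell R) : normA (0 : KHspace I) = 0.
Proof.
have [_ [x Ix <-]] := normA_attained (0 : KHspace I).
by rewrite -(scale0r 0) primZ // mul0r normr0.
Qed.

(** A value phi y <= phi x with x < y would be taken again between min I and x,
    as phi starts from the least possible value. *)
Lemma homeo_increasing (K I : cell R) (phi psi : R -> R) :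
  set_fun (cset I) (cset K) phi -> {within cset I, continuous phi} ->
  phi (cmin I) = cmin K -> (forall x, cset I x -> psi (phi x) = x) ->
  forall x y, cset I x -> cset I y -> x < y -> phi x < phi y.
Proof.
move=> phiK cphi phi0 psiphi x y Ix Iy xy.
have inj u v : cset I u -> cset I v -> phi u = phi v -> u = v.
  by move=> Iu Iv E; rewrite -(psiphi u) // E psiphi.
rewrite ltNge; apply/negP => le_yx.
have /csetP/andP[ax xb] := Ix.
have sub : `[cmin I, x] `<=` cset I.
  by move=> z /=; rewrite in_itv /= => /andP[az zx]; apply/csetP; rewrite az (le_trans zx).
have [] := @IVT _ phi (cmin I) x (phi y) ax (continuous_subspaceW sub cphi).
  rewrite ge_min le_max le_yx orbT andbT phi0.
  by have /csetP/andP[-> _] := phiK y Iy.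
move=> z zx E; have zy : z = y by apply: inj => //; exact: sub.
by move: zx; rewrite zy in_itv /= => /andP[_]; rewrite leNgt xy.
Qed.

Lemma increasing_le (A : set R) (phi : R -> R) :
  (forall x y, A x -> A y -> x < y -> phi x < phi y) ->
  forall x y, A x -> A y -> x <= y -> phi x <= phi y.
Proof.
by move=> H x y Ax Ay; rewrite le_eqVlt => /predU1P[->//|/(H _ _ Ax Ay)/ltW].
Qed.

(** The map phi is an increasing primitive, hence absolutely continuous, and so
    is its inverse, by symmetry. The chain rule identifies T F, since a class
    is determined by its primitive. *)
Lemma isometry_substitution (I K : cell R) (T : {linear KHspace K -> KHspace I}) :
  surjective_isometry T ->
  exists (sigma : R) (phi psi : R -> R),
    [/\ sigma = -1 \/ sigma = 1,
        increasing_homeo I K phi psi,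
        abs_continuous I phi,
        abs_continuous K psi
      & forall (F : KHspace K) (f : R -> R), in_class F f ->
          in_class (T F) (fun x => sigma * f (phi x) * derivative0 phi x)].
Proof.
move=> [isoT surjT]; have [S ST] := choice surjT.
have linT a F G : T (a *: F + G) = a *: T F + T G by exact: linearP.
have nT := linear_isometry_norm linT isoT.
have injT : injective T.
  move=> F G FG; apply/eqP; rewrite -subr_eq0; apply/eqP/normA_eq0.
  by rewrite -isoT FG subrr normA0.
have TS : cancel T S by move=> F; apply: injT.
have linS a F G : S (a *: F + G) = a *: S F + S G.
  by apply: injT; rewrite linT !ST.
have nS H : normA (S H) = normA H by rewrite -nT ST.
have [sigma [phi [h [sigma1 phiK phi0 hphi TE]]]] :=
  isometry_representation linS nS TS ST.
have [sigma' [psi [h' [sigma'1 psiI psi0 hpsi SE]]]] :=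
  isometry_representation linT nT ST TS.
have cont (J : cell R) g Phi : primitive J g Phi -> {within cset J, continuous Phi}.
  by move=> gPhi; apply/within_continuousP => x Jx; exact: primitive_cvg gPhi Jx.
have cphi := cont _ _ _ hphi; have cpsi := cont _ _ _ hpsi.
have [U _ UE] := prim_surj (primitive_id K) (subrr _).
have [V _ VE] := prim_surj (primitive_id I) (subrr _).
(* T and S represent inverse maps, which fixes the product of the signs and
   makes phi and psi inverse to each other *)
have ss y : cset K y -> y - cmin K = sigma' * sigma * (phi (psi y) - cmin K).
  move=> Ky; have Ipy := psiI _ Ky; have Kpy := phiK _ Ipy.
  by rewrite -UE // -[X in prim X y]TS SE // TE // UE // mulrA.
have ss1 : sigma' * sigma = 1.
  have bK := cset_max K; have := ss _ bK; have := cmin_lt K.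
  have /csetP/andP[le _] := phiK _ (psiI _ bK).
  by case: sigma1 => ->; case: sigma'1 => -> //; rewrite ?mulN1r ?mulr1 ?opprK //; lra.
have phipsi y : cset K y -> phi (psi y) = y.
  by move=> Ky; have := ss y Ky; rewrite ss1 mul1r => /addIr.
have psiphi x : cset I x -> psi (phi x) = x.
  move=> Ix; have Kpx := phiK _ Ix; have Ipx := psiI _ Kpx.
  have := VE x Ix; rewrite -[X in prim X x]ST TE // SE //.
  by rewrite mulrA (mulrC sigma) ss1 mul1r VE // => /addIr.
have phi_lt := homeo_increasing phiK cphi phi0 psiphi.
have psi_lt := homeo_increasing psiI cpsi psi0 phipsi.
have phi_le := increasing_le phi_lt; have psi_le := increasing_le psi_lt.
have nphi := primitive_null_cont hphi; have npsi := primitive_null_cont hpsi.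
exists sigma, phi, psi; split=> //.
- split; split=> //.
  + by move=> x; rewrite inE; exact: psiphi.
  + by move=> y; rewrite inE; exact: phipsi.
  + by move=> x y; rewrite !inE; exact: phi_lt.
- exact: null_cont_abs_continuous phi_le cphi nphi.
- exact: null_cont_abs_continuous psi_le cpsi npsi.
move=> F f Ff; apply: prim_in_class.
have dphi := null_cont_primitive phi_le cphi nphi.
have phi_lt' : {in cset I &, {homo phi : x y / x < y}}.
  by move=> x y; rewrite !inE; exact: phi_lt.
have := primitiveZ sigma (primitive_comp phiK cphi phi_lt' dphi (prim_primitive Ff)).
move=> H; rewrite (_ : (fun x => _) = sigma *: (fun x => f (phi x) * derivative0 phi x)).
  by apply: primitive_congr H => x Ix; rewrite TE.
by apply/funext => x; rewrite scalrfctE /GRing.scale /= mulrA.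
Qed.

(** T acts on primitives by F |-> sigma * (F o phi). A preimage of H is the class
    of sigma * (h o psi) * psi', whose primitive is sigma * (prim H o psi). *)
Lemma substitution_isometry (I K : cell R) (T : {linear KHspace K -> KHspace I})
    (sigma : R) (phi psi : R -> R) :
  sigma = -1 \/ sigma = 1 -> increasing_homeo I K phi psi ->
  abs_continuous I phi -> abs_continuous K psi ->
  (forall (F : KHspace K) (f : R -> R), in_class F f ->
     in_class (T F) (fun x => sigma * f (phi x) * derivative0 phi x)) ->
  surjective_isometry T.
Proof.
move=> sigma1 [[phiK psiI psiphi' phipsi'] [cphi cpsi phi_lt']] acphi acpsi HT.
have psiphi x : cset I x -> psi (phi x) = x by move=> Ix; apply: psiphi'; rewrite inE.
have phipsi y : cset K y -> phi (psi y) = y by move=> Ky; apply: phipsi'; rewrite inE.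
have phi_lt x y : cset I x -> cset I y -> x < y -> phi x < phi y.
  by move=> Ix Iy; apply: phi_lt'; rewrite inE.
have phi_le := increasing_le phi_lt.
have psi_lt x y : cset K x -> cset K y -> x < y -> psi x < psi y.
  move=> Kx Ky xy; rewrite ltNge; apply/negP => /(phi_le _ _ (psiI _ Ky) (psiI _ Kx)).
  by rewrite !phipsi // leNgt xy.
have psi_le := increasing_le psi_lt.
have phi0 : phi (cmin I) = cmin K.
  have Imin := cset_min I; have Kmin := cset_min K.
  have /csetP/andP[le1 _] := phiK _ Imin; apply/eqP; rewrite eq_le le1 andbT.
  rewrite -[leRHS](phipsi _ Kmin); apply: phi_le => //; first exact: psiI.
  by have /csetP/andP[] := psiI _ Kmin.
have psi0 : psi (cmin K) = cmin I by rewrite -phi0 psiphi //; exact: cset_min.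
have dphi := null_cont_primitive phi_le cphi (abs_continuous_null_cont acphi).
have dpsi := null_cont_primitive psi_le cpsi (abs_continuous_null_cont acpsi).
have psi_lt' : {in cset K &, {homo psi : x y / x < y}}.
  by move=> x y; rewrite !inE; exact: psi_lt.
have sigma2 : sigma * sigma = 1 by case: sigma1 => ->; ring.
have TE F x : cset I x -> prim (T F) x = sigma * prim F (phi x).
  move=> Ix; have Fr := in_class_repr F.
  have := primitiveZ sigma (primitive_comp phiK cphi phi_lt' dphi (prim_primitive Fr)).
  set g := sigma *: _ => gF.
  have Tg : in_class (T F) g.
    rewrite (_ : g = fun x => sigma * KHval (repr F) (phi x) * derivative0 phi x).
      exact: HT.
    by apply/funext => y; rewrite /g scalrfctE /GRing.scale /= mulrA.
  rewrite (prim_unique Tg gF) //.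
  by rewrite scalrfctE /= phi0 prim_min scaler0.
have nT F : normA (T F) = normA F.
  have ns (z : R) : `|sigma * z| = `|z|.
    by case: sigma1 => ->; rewrite ?mulN1r ?normrN ?mul1r.
  apply/eqP; rewrite eq_le; apply/andP; split.
    have [_ [x Ix <-]] := normA_attained (T F).
    by rewrite TE // ns; apply: normA_ge; exact: phiK.
  have [_ [y Ky <-]] := normA_attained F.
  have Ipy := psiI _ Ky; apply: le_trans (normA_ge (T F) Ipy).
  by rewrite TE // ns phipsi.
split=> [F G|H]; first by rewrite -linearB nT.
have Hr := in_class_repr H.
have := primitiveZ sigma (primitive_comp psiI cpsi psi_lt' dpsi (prim_primitive Hr)).
move=> /prim_surj[|F _ FE]; first by rewrite scalrfctE /= psi0 prim_min scaler0.
exists F; apply: prim_inj => x Ix.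
rewrite TE // FE; last exact: phiK.
have -> : (sigma *: (prim H \o psi)) (phi x) = sigma * prim H (psi (phi x)) by [].
by rewrite psiphi // mulrA sigma2 mul1r.
Qed.

End Main.

Theorem mainTheorem1 (R : realType) (I It : cell R)
    (T : {linear KHspace It -> KHspace I}) :
  surjective_isometry T <->
  exists (sigma : R) (phi psi : R -> R),
    [/\ sigma = -1 \/ sigma = 1,
        increasing_homeo I It phi psi,
        abs_continuous I phi,
        abs_continuous It psi
      & forall (F : KHspace It) (f : R -> R), in_class F f ->
          in_class (T F) (fun x => sigma * f (phi x) * derivative0 phi x)].
Proof.
split; first exact: isometry_substitution.
move=> [sigma [phi [psi [? ? ? ? ?]]]].
exact: (@substitution_isometry R I It T sigma phi psi).
Qed.
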